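(* For a critical point $\gamma$ of the modified Sadowsky functional $S_\mu$, the tangent vector $T$ of $\gamma$, with spherical (geodesic) curvature $\lambda$, is a critical point of the P-functional $$P(T)=2\int_0^{\tilde L}\sqrt{\langle T,b_0\rangle-\mu}\,(1+\lambda^2)\,ds.$$
   Context: Let $\gamma:[0,L]\to\mathbb{R}^3$ be a regular Frenet curve with speed $v=|\gamma'|$, curvature $\kappa$, torsion $\tau$ and modified torsion $\lambda=\tau/\kappa$. For $\mu\in\mathbb{R}$ the modified Sadowsky functional is $$S_\mu(\gamma)=\int_0^L\left(\kappa^2(1+\lambda^2)^2-\mu\right)v\,dt;$$ its critical points are the critical points of $\int\kappa^2(1+\lambda^2)^2\,ds$ among curves with fixed end points and fixed length, $\mu$ being the Lagrange multiplier for the length constraint. The tangent vector $T=\gamma'/|\gamma'|$ is regarded as a curve in the unit sphere $S^2$; its geodesic curvature equals the modified torsion $\lambda$ of $\gamma$. The P-functional is defined for arclength parametrized spherical curves $T:[0,\tilde L]\to S^2$ with geodesic curvature $\lambda$, by the formula in the claim. In it the scalar $\mu$ and the constant vector $b_0\in\mathbb{R}^3$ are Lagrange multipliers: $\mu$ belongs to the constraint that the length of $\gamma$ is held fixed, and $b_0$ to the constraint that the end points of $\gamma$ are held fixed. *)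

(* Defs.v *)
From Stdlib Require Import Reals.
From Coquelicot Require Import Coquelicot.

Open Scope R_scope.

Definition R3 : Type := (R * R * R)%type.

Definition X1 (u : R3) : R := fst (fst u).
Definition X2 (u : R3) : R := snd (fst u).
Definition X3 (u : R3) : R := snd u.

(* Sums, differences and scalar multiples in R3 are the [plus], [minus] and
   [scal] of the product structure.  The Euclidean norm is [norm3]: the [norm]
   of the product structure is nested over the pairs and is not used. *)
Definition dot (u v : R3) : R := X1 u * X1 v + X2 u * X2 v + X3 u * X3 v.

Definition norm3 (u : R3) : R := sqrt (dot u u).

Definition cross (u v : R3) : R3 :=
  (X2 u * X3 v - X3 u * X2 v,
   X3 u * X1 v - X1 u * X3 v,
   X1 u * X2 v - X2 u * X1 v).

(* A smooth curve on [0, l] is represented by a C^oo extension to R; nothing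
   below depends on the choice of the extension. *)
Definition smooth (f : R -> R) : Prop := forall n t, ex_derive_n f n t.

Definition smooth_curve (c : R -> R3) : Prop :=
  smooth (fun t => X1 (c t)) /\
  smooth (fun t => X2 (c t)) /\
  smooth (fun t => X3 (c t)).

Definition smooth2 (f : R -> R -> R) : Prop := forall n e t, ex_diff_n f n e t.

Definition smooth_family (C : R -> R -> R3) : Prop :=
  smooth2 (fun e t => X1 (C e t)) /\
  smooth2 (fun e t => X2 (C e t)) /\
  smooth2 (fun e t => X3 (C e t)).

Definition D (c : R -> R3) (t : R) : R3 :=
  (Derive (fun u => X1 (c u)) t,
   Derive (fun u => X2 (c u)) t,
   Derive (fun u => X3 (c u)) t).

Definition speed (c : R -> R3) (t : R) : R := norm3 (D c t).

Definition arclength (c : R -> R3) (t : R) : R := RInt (speed c) 0 t.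

(* Frenet apparatus in an arbitrary regular parametrization, with
   N' = v (- kappa T + tau B). *)
Definition tangent (c : R -> R3) (t : R) : R3 := scal (/ speed c t) (D c t).

Definition curvature (c : R -> R3) (t : R) : R :=
  norm3 (D (tangent c) t) / speed c t.

Definition normal (c : R -> R3) (t : R) : R3 :=
  scal (/ norm3 (D (tangent c) t)) (D (tangent c) t).

Definition binormal (c : R -> R3) (t : R) : R3 :=
  cross (tangent c t) (normal c t).

Definition torsion (c : R -> R3) (t : R) : R :=
  dot (D (normal c) t) (binormal c t) / speed c t.

Definition modified_torsion (c : R -> R3) (t : R) : R :=
  torsion c t / curvature c t.

Definition frenet_curve (L : R) (g : R -> R3) : Prop :=
  smooth_curve g /\
  forall t, 0 <= t <= L -> 0 < speed g t /\ 0 < curvature g t.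

Definition Sadowsky (mu L : R) (g : R -> R3) : R :=
  RInt (fun t => (curvature g t ^ 2 * (1 + modified_torsion g t ^ 2) ^ 2 - mu)
                 * speed g t) 0 L.

(* The parameter e ranges over all of R without loss of generality, since only
   derivatives at e = 0 are taken and a family on (-a, a) can be composed with
   a smooth map R -> (-a, a) equal to the identity near 0.  For small e the
   members of a variation of a Frenet curve are Frenet curves on [0, L], by
   compactness. *)

(* Near either end of [0, L] the varied curve is the original one up to a
   translation; the two translations may differ and may depend on e. *)
Definition variation (L : R) (g : R -> R3) (G : R -> R -> R3) : Prop :=
  smooth_family G /\
  (forall t, 0 <= t <= L -> G 0 t = g t) /\
  exists d, 0 < d /\
    forall e t, 0 <= t <= L ->
      (t <= d -> minus (G e t) (g t) = minus (G e 0) (g 0)) /\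
      (L - d <= t -> minus (G e t) (g t) = minus (G e L) (g L)).

(* With fixed end points these are exactly the variations that are compactly
   supported in (0, L). *)
Definition fixed_ends_variation (L : R) (g : R -> R3) (G : R -> R -> R3)
  : Prop :=
  variation L g G /\ forall e, G e 0 = g 0 /\ G e L = g L.

Definition Sadowsky_critical (mu L : R) (g : R -> R3) : Prop :=
  forall G, fixed_ends_variation L g G ->
    is_derive (fun e => Sadowsky mu L (G e)) 0 0.

(* b0 is the Lagrange multiplier of the constraint that g(L) - g(0), that is
   the integral of v T, is held fixed. *)
Definition endpoint_multiplier (mu L : R) (g : R -> R3) (b0 : R3) : Prop :=
  forall G, variation L g G ->
    is_derive
      (fun e => Sadowsky mu L (G e) + dot b0 (minus (G e L) (G e 0))) 0 0.

(* c parametrizes the tangent image of g by its own arclength, on [0, l].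
   For a Frenet curve g this forces |c| = |c'| = 1 on [0, l] and determines l
   and the restriction of c to [0, l]. *)
Definition arclength_tangent (L : R) (g : R -> R3) (l : R) (c : R -> R3)
  : Prop :=
  smooth_curve c /\
  l = arclength (tangent g) L /\
  forall t, 0 <= t <= L -> c (arclength (tangent g) t) = tangent g t.

(* Oriented by the normal c x c'/|c'| of a regular spherical curve c. *)
Definition geodesic_curvature (c : R -> R3) (s : R) : R :=
  dot (D (tangent c) s) (cross (c s) (tangent c s)) / speed c s.

(* The arclength element is written |c'| ds, so that the functional is also
   defined on the varied curves, which need not have unit speed: their length
   is not constrained. *)
Definition Pfun (mu : R) (b0 : R3) (l : R) (c : R -> R3) : R :=
  2 * RInt (fun s => sqrt (dot (c s) b0 - mu)
                     * (1 + geodesic_curvature c s ^ 2) * speed c s) 0 l.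

Definition spherical_variation (l : R) (c : R -> R3) (V : R -> R -> R3)
  : Prop :=
  smooth_family V /\
  (forall e s, 0 <= s <= l -> norm3 (V e s) = 1) /\
  (forall s, 0 <= s <= l -> V 0 s = c s) /\
  exists d, 0 < d /\
    forall e s, 0 <= s <= l -> s <= d \/ l - d <= s -> V e s = c s.

(* The sign condition puts c in the domain of the functional, where the square
   root is smooth ([sqrt] is 0 on negative reals). *)
Definition P_critical (mu : R) (b0 : R3) (l : R) (c : R -> R3) : Prop :=
  (forall s, 0 <= s <= l -> 0 < dot (c s) b0 - mu) /\
  forall V, spherical_variation l c V ->
    is_derive (fun e => Pfun mu b0 l (V e)) 0 0.

(* Main.v *)
(** For a fixed tangent image the functional, with the end point multiplier b0
    added, reads [int (x^2 + f) v dt], where [x = kappa (1 + lambda^2)] is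
    inversely proportional to the speed [v] and [f = <T, b0> - mu].  Variations
    of the speed alone give the Euler-Lagrange equation [x^2 = f], so [f > 0].
    Given a variation V of the tangent image, the curves with the speed of gamma
    and tangent image V form an admissible variation of gamma, along which
    [int (x^2 + f) v] dominates the P-functional [int 2 sqrt(f) x v], the
    difference being [int (x - sqrt f)^2 v]; both agree at the start.  Hence the
    derivative of the P-functional vanishes together with that of the first. *)

From Stdlib Require Import Reals Lra Lia FunctionalExtensionality.
From Coquelicot Require Import Coquelicot.
Require Import Defs.

Open Scope R_scope.

(** Comparing two functionals at a point of contact replaces the Euler-Lagrange equation of the
    P-functional, which is never computed. The comparison curves are given by their velocity, so
    their far end moves with the parameter: criticality under fixed ends does not apply to them
    directly, and this is why a multiplier [b0] valid for all variations with translated ends has to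
    be produced beforehand. The analytic obstacle is that the integrands contain roots and quotients
    that are smooth only where speed and curvature are positive, while differentiation under the
    integral sign is applied to functions smooth on the whole plane. The Frenet quantities are
    therefore expressed through [gram1], [gram2] and [triple], which are polynomial in the
    derivatives, and roots and inverses are clamped away from 0. A compactness bound shows that for
    parameters near 0 the clamping changes nothing on [0, L]. Derivatives of a curve that is known
    only on [0, L] are compared by locality inside the interval and by continuity at its ends. *)

(** * Smooth functions of one variable *)

Fixpoint Ck (n : nat) (f : R -> R) : Prop :=
  match n with
  | O => True
  | S m => (forall t, ex_derive f t) /\ Ck m (Derive f)
  end.

Lemma Derive_n_Derive (f : R -> R) (n : nat) :
  Derive_n (Derive f) n = Derive_n f (S n).
Proof.
  apply functional_extensionality; intros t.
  replace (S n) with (n + 1)%nat by lia.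
  now rewrite <- Derive_n_comp.
Qed.

(** [Ck] strips the innermost derivative, whereas [ex_derive_n] strips the outermost one. With [Ck]
    the closure under products and composition is an induction on the order, because the first
    derivative is again built from functions of the same kind. *)
Lemma smooth_Ck (f : R -> R) : smooth f <-> forall n, Ck n f.
Proof.
  split.
  - intros H n; revert f H; induction n as [|n IH]; intros f H; simpl; [easy|].
    split; [exact (H 1%nat)|].
    apply IH; intros [|k] t; simpl; [easy|].
    rewrite Derive_n_Derive; exact (H (S (S k)) t).
  - intros H n; revert f H; induction n as [|n IH]; intros f H t; simpl; [easy|].
    destruct n as [|n]; [exact (proj1 (H 1%nat) t)|].
    rewrite <- Derive_n_Derive.
    exact (IH (Derive f) (fun k => proj2 (H (S k))) t).
Qed.

Lemma smooth_ex_derive (f : R -> R) (t : R) : smooth f -> ex_derive f t.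
Proof. intros H; exact (H 1%nat t). Qed.

Lemma smooth_Derive (f : R -> R) : smooth f -> smooth (Derive f).
Proof.
  rewrite !smooth_Ck; intros H n; exact (proj2 (H (S n))).
Qed.

Lemma smooth_continuous (f : R -> R) (t : R) : smooth f -> continuous f t.
Proof. intros H; apply (ex_derive_continuous f), smooth_ex_derive, H. Qed.

Lemma smooth_ex_RInt (f : R -> R) (a b : R) : smooth f -> ex_RInt f a b.
Proof.
  intros H; apply (ex_RInt_continuous (V := R_CompleteNormedModule)).
  intros z _; now apply smooth_continuous.
Qed.

Lemma Ck_S (n : nat) (f : R -> R) : Ck (S n) f -> Ck n f.
Proof.
  revert f; induction n as [|n IH]; intros f H; simpl; [easy|].
  split; [apply H|apply IH, H].
Qed.

Lemma Ck_const (n : nat) (c : R) : Ck n (fun _ => c).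
Proof.
  revert c; induction n as [|n IH]; intros c; simpl; [easy|].
  split; [intros t; apply ex_derive_const|].
  replace (Derive (fun _ => c)) with (fun _ : R => 0); [apply IH|].
  apply functional_extensionality; intros t; now rewrite Derive_const.
Qed.

Lemma Ck_plus (n : nat) (f g : R -> R) :
  Ck n f -> Ck n g -> Ck n (fun t => f t + g t).
Proof.
  revert f g; induction n as [|n IH]; intros f g Hf Hg; simpl; [easy|].
  destruct Hf as [Hf Hf'], Hg as [Hg Hg'].
  split; [intros t; now apply (ex_derive_plus f g)|].
  replace (Derive (fun t => f t + g t)) with (fun t => Derive f t + Derive g t);
    [now apply IH|].
  apply functional_extensionality; intros t; now rewrite Derive_plus.
Qed.

Lemma Ck_mult (n : nat) (f g : R -> R) :
  Ck n f -> Ck n g -> Ck n (fun t => f t * g t).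
Proof.
  revert f g; induction n as [|n IH]; intros f g Hf Hg; [easy|].
  pose proof (Ck_S _ _ Hf) as Hf0; pose proof (Ck_S _ _ Hg) as Hg0.
  destruct Hf as [Hf Hf'], Hg as [Hg Hg'].
  split; [intros t; now apply ex_derive_mult|].
  replace (Derive (fun t => f t * g t))
    with (fun t => Derive f t * g t + f t * Derive g t);
    [apply Ck_plus; now apply IH|].
  apply functional_extensionality; intros t; now rewrite Derive_mult.
Qed.

Lemma Ck_comp (n : nat) (f g : R -> R) :
  Ck n f -> Ck n g -> Ck n (fun t => f (g t)).
Proof.
  revert f g; induction n as [|n IH]; intros f g Hf Hg; [easy|].
  pose proof (Ck_S _ _ Hg) as Hg0.
  destruct Hf as [Hf Hf'], Hg as [Hg Hg'].
  split; [intros t; now apply ex_derive_comp|].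
  replace (Derive (fun t => f (g t)))
    with (fun t => Derive g t * Derive f (g t));
    [apply Ck_mult; [easy|]; now apply IH|].
  apply functional_extensionality; intros t; now rewrite (Derive_comp f g).
Qed.

Lemma smooth_const (c : R) : smooth (fun _ => c).
Proof. apply smooth_Ck; intros n; apply Ck_const. Qed.

Lemma smooth_plus (f g : R -> R) :
  smooth f -> smooth g -> smooth (fun t => f t + g t).
Proof. rewrite !smooth_Ck; intros Hf Hg n; now apply Ck_plus. Qed.

Lemma smooth_mult (f g : R -> R) :
  smooth f -> smooth g -> smooth (fun t => f t * g t).
Proof. rewrite !smooth_Ck; intros Hf Hg n; now apply Ck_mult. Qed.

Lemma smooth_comp (f g : R -> R) :
  smooth f -> smooth g -> smooth (fun t => f (g t)).
Proof. rewrite !smooth_Ck; intros Hf Hg n; now apply Ck_comp. Qed.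

Lemma smooth_of_Derive (f f' : R -> R) :
  (forall t, is_derive f t (f' t)) -> smooth f' -> smooth f.
Proof.
  rewrite !smooth_Ck; intros H Hf' [|n]; simpl; [easy|].
  split; [intros t; now exists (f' t)|].
  replace (Derive f) with f'; [easy|].
  apply functional_extensionality; intros t; symmetry; now apply is_derive_unique.
Qed.

Lemma smooth_id : smooth (fun t => t).
Proof.
  apply (smooth_of_Derive _ (fun _ => 1)); [|apply smooth_const].
  intros t; apply (is_derive_id (K := R_AbsRing)).
Qed.

Lemma smooth_opp (f : R -> R) : smooth f -> smooth (fun t => - f t).
Proof.
  intros H; replace (fun t => - f t) with (fun t => (-1) * f t).
  - apply smooth_mult; [apply smooth_const|easy].
  - apply functional_extensionality; intros t; ring.
Qed.

Lemma smooth_minus (f g : R -> R) :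
  smooth f -> smooth g -> smooth (fun t => f t - g t).
Proof. intros Hf Hg; apply smooth_plus; [easy|]; now apply smooth_opp. Qed.

Lemma smooth_exp : smooth exp.
Proof.
  apply smooth_Ck; intros n; induction n as [|n IH]; simpl; [easy|].
  split; [intros t; exists (exp t); apply is_derive_exp|].
  replace (Derive exp) with exp; [easy|].
  apply functional_extensionality; intros t; symmetry; apply is_derive_unique, is_derive_exp.
Qed.

(** The derivative is [- f'] times two copies of [/ f], so the induction on the order closes for a
    fixed [f]. *)
Lemma smooth_inv (f : R -> R) :
  smooth f -> (forall t, f t <> 0) -> smooth (fun t => / f t).
Proof.
  intros Hf H0; apply smooth_Ck; intros n; induction n as [|n IH]; [easy|].
  split; [intros t; apply ex_derive_inv; [now apply smooth_ex_derive|easy]|].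
  replace (Derive (fun t => / f t))
    with (fun t => (-1 * Derive f t) * (/ f t * / f t)).
  - apply Ck_mult; [apply Ck_mult; [apply Ck_const|]|now apply Ck_mult].
    now apply smooth_Ck, smooth_Derive.
  - apply functional_extensionality; intros t; rewrite Derive_inv.
    + field; apply H0.
    + now apply smooth_ex_derive.
    + apply H0.
Qed.

Lemma smooth_sqrt (f : R -> R) :
  smooth f -> (forall t, 0 < f t) -> smooth (fun t => sqrt (f t)).
Proof.
  intros Hf H0.
  assert (Hd : forall t, is_derive (fun t => sqrt (f t)) t
                           (Derive f t * / 2 * / sqrt (f t))).
  { intros t; auto_derive.
    - split; [now apply smooth_ex_derive|easy].
    - change (Derive (fun x => f x) t) with (Derive f t); field; apply Rgt_not_eq, sqrt_lt_R0, H0. }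
  apply smooth_Ck; intros n; induction n as [|n IH]; [easy|].
  split; [intros t; eexists; apply Hd|].
  (* Writing [1 / sqrt f] as [sqrt f / f] makes [sqrt f] itself reappear, so that the induction
     hypothesis applies. *)
  replace (Derive (fun t => sqrt (f t)))
    with (fun t => Derive f t * (/ 2 * (sqrt (f t) * / f t))).
  - apply Ck_mult; [now apply smooth_Ck, smooth_Derive|].
    apply Ck_mult; [apply Ck_const|].
    apply Ck_mult; [easy|].
    apply smooth_Ck, smooth_inv; [easy|intros t; apply Rgt_not_eq, H0].
  - apply functional_extensionality; intros t.
    transitivity (Derive f t * / 2 * / sqrt (f t));
      [|symmetry; apply is_derive_unique, Hd].
    pose proof (sqrt_lt_R0 _ (H0 t)) as Hs.
    pose proof (sqrt_def (f t) (Rlt_le _ _ (H0 t))) as Hq.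
    set (s := sqrt (f t)) in *; rewrite <- Hq; field; lra.
Qed.

(** * A smooth cutoff function *)

(** The powers of [/ x] are included because the derivative of [exp (- / x)] leaves the single
    function but not this family: [flat n] has a derivative in the span of [flat (n + 1)] and
    [flat (n + 2)]. *)
Definition flat (n : nat) (x : R) : R :=
  if Rlt_dec 0 x then (/ x) ^ n * exp (- / x) else 0.

Lemma flat_pos_eq (n : nat) (x : R) : 0 < x -> flat n x = (/ x) ^ n * exp (- / x).
Proof. intros H; unfold flat; destruct (Rlt_dec 0 x); [easy|lra]. Qed.

Lemma flat_nonpos (n : nat) (x : R) : x <= 0 -> flat n x = 0.
Proof. intros H; unfold flat; destruct (Rlt_dec 0 x); [lra|easy]. Qed.

(** Raise [y / m <= exp (y / m)] to the power [m]. *)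
Lemma pow_exp_bound (m : nat) (y : R) :
  (0 < m)%nat -> 0 <= y -> y ^ m * exp (- y) <= INR m ^ m.
Proof.
  intros Hm Hy.
  assert (Hm' : 0 < INR m) by now apply lt_0_INR.
  assert (H : y ^ m <= INR m ^ m * exp y).
  { replace (exp y) with (exp (y / INR m) ^ m).
    - rewrite <- Rpow_mult_distr; apply pow_incr; split; [easy|].
      replace y with (INR m * (y / INR m)) at 1 by (field; lra).
      apply Rmult_le_compat_l; [lra|].
      pose proof (exp_ineq1_le (y / INR m)); lra.
    - clear -Hm'.
      assert (E : forall k, exp (y / INR m) ^ k = exp (INR k * (y / INR m))).
      { induction k as [|k IH]; [simpl; now rewrite Rmult_0_l, exp_0|].
        rewrite <- tech_pow_Rmult, IH, <- exp_plus, S_INR; f_equal; ring. }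
      rewrite E; f_equal; field; lra. }
  rewrite exp_Ropp.
  apply Rmult_le_reg_r with (exp y); [apply exp_pos|].
  rewrite Rmult_assoc, Rinv_l, Rmult_1_r; [easy|].
  apply Rgt_not_eq, exp_pos.
Qed.

(** Two powers of [/ x] more than in [flat n] are still dominated by the exponential, which leaves
    the factor [x * x]. A quadratic bound makes the difference quotient at 0 tend to 0. *)
Lemma flat_quadratic (n : nat) (x : R) :
  Rabs (flat n x) <= INR (n + 2) ^ (n + 2) * (x * x).
Proof.
  assert (Hc : 0 <= INR (n + 2) ^ (n + 2)) by (apply pow_le, pos_INR).
  destruct (Rlt_dec 0 x) as [H|H].
  - assert (Hi : 0 < / x) by now apply Rinv_0_lt_compat.
    rewrite flat_pos_eq by easy.
    rewrite Rabs_pos_eq by (apply Rmult_le_pos; [apply pow_le; lra|apply Rlt_le, exp_pos]).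
    replace ((/ x) ^ n * exp (- / x)) with ((/ x) ^ (n + 2) * exp (- / x) * (x * x)).
    + apply Rmult_le_compat_r; [nra|]; apply pow_exp_bound; [lia|lra].
    + rewrite pow_add; simpl; field; lra.
  - rewrite flat_nonpos by lra; rewrite Rabs_R0; nra.
Qed.

Lemma is_derive_flat (n : nat) (x : R) :
  is_derive (flat n) x (- INR n * flat (n + 1) x + flat (n + 2) x).
Proof.
  destruct (total_order_T 0 x) as [[H|H]|H].
  - apply (is_derive_ext_loc (fun x => (/ x) ^ n * exp (- / x))).
    + exists (mkposreal x H); intros y Hy.
      rewrite flat_pos_eq; [easy|].
      unfold ball in Hy; simpl in Hy; unfold AbsRing_ball, abs, minus, plus, opp in Hy; simpl in Hy.
      apply Rabs_def2 in Hy; lra.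
    + rewrite !flat_pos_eq by easy.
      auto_derive; [repeat split; lra|].
      destruct n as [|n].
      * simpl; field; lra.
      * replace (pred (S n)) with n by easy.
        replace (S n + 1)%nat with (S (S n)) by lia.
        replace (S n + 2)%nat with (S (S (S n))) by lia.
        rewrite <- !tech_pow_Rmult; field; lra.
  - subst x; rewrite !flat_nonpos by lra.
    replace (- INR n * 0 + 0) with 0 by ring.
    apply is_derive_Reals; intros eps Heps.
    set (c := INR (n + 2) ^ (n + 2)).
    assert (Hc : 0 <= c) by (apply pow_le, pos_INR).
    assert (Hd : 0 < eps / (c + 1)) by (apply Rdiv_lt_0_compat; lra).
    exists (mkposreal _ Hd); intros h Hh0 Hh; simpl in Hh.
    rewrite (flat_nonpos n 0), Rplus_0_l, !Rminus_0_r by lra.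
    unfold Rdiv; rewrite Rabs_mult, Rabs_inv.
    pose proof (flat_quadratic n h) as Hq; fold c in Hq.
    assert (Hp : 0 < Rabs h) by now apply Rabs_pos_lt.
    apply Rmult_lt_reg_r with (Rabs h); [easy|].
    rewrite Rmult_assoc, Rinv_l, Rmult_1_r by lra.
    apply Rle_lt_trans with (1 := Hq).
    replace (h * h) with (Rabs h * Rabs h) by (rewrite <- Rabs_mult; apply Rabs_pos_eq; nra).
    rewrite <- Rmult_assoc; apply Rmult_lt_compat_r; [easy|].
    apply Rle_lt_trans with (c * (eps / (c + 1))); [apply Rmult_le_compat_l; lra|].
    apply Rmult_lt_reg_r with (c + 1); [lra|].
    replace (c * (eps / (c + 1)) * (c + 1)) with (c * eps) by (field; lra); nra.
  - apply (is_derive_ext_loc (fun _ => 0)).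
    + assert (H' : 0 < - x) by lra.
      exists (mkposreal _ H'); intros y Hy.
      rewrite flat_nonpos; [easy|].
      unfold ball in Hy; simpl in Hy; unfold AbsRing_ball, abs, minus, plus, opp in Hy; simpl in Hy.
      apply Rabs_def2 in Hy; lra.
    + rewrite !flat_nonpos by lra.
      replace (- INR n * 0 + 0) with 0 by ring.
      exact (is_derive_const (K := R_AbsRing) (V := R_NormedModule) 0 x).
Qed.

Lemma smooth_flat (n : nat) : smooth (flat n).
Proof.
  apply smooth_Ck; intros k; revert n; induction k as [|k IH]; intros n; [easy|].
  split; [intros t; eexists; apply is_derive_flat|].
  replace (Derive (flat n)) with (fun x => - INR n * flat (n + 1) x + flat (n + 2) x).
  - apply Ck_plus; [apply Ck_mult; [apply Ck_const|]|]; apply IH.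
  - apply functional_extensionality; intros t; symmetry; apply is_derive_unique, is_derive_flat.
Qed.

Lemma flat_pos (n : nat) (x : R) : 0 < x -> 0 < flat n x.
Proof.
  intros H; rewrite flat_pos_eq by easy.
  apply Rmult_lt_0_compat; [apply pow_lt, Rinv_0_lt_compat, H|apply exp_pos].
Qed.

Lemma flat_nonneg (n : nat) (x : R) : 0 <= flat n x.
Proof.
  destruct (Rlt_dec 0 x); [now apply Rlt_le, flat_pos|rewrite flat_nonpos; lra].
Qed.

Definition step (x : R) : R := flat 0 x / (flat 0 x + flat 0 (1 - x)).

Lemma step_denominator (x : R) : 0 < flat 0 x + flat 0 (1 - x).
Proof.
  pose proof (flat_nonneg 0 x); pose proof (flat_nonneg 0 (1 - x)).
  destruct (Rlt_dec 0 x).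
  - pose proof (flat_pos 0 x); lra.
  - pose proof (flat_pos 0 (1 - x)); lra.
Qed.

Lemma smooth_step : smooth step.
Proof.
  assert (H : smooth (fun x => flat 0 (1 - x))).
  { apply (smooth_comp (flat 0) (fun x => 1 - x)); [apply smooth_flat|].
    apply smooth_minus; [apply smooth_const|apply smooth_id]. }
  apply smooth_mult; [apply smooth_flat|].
  apply smooth_inv; [apply smooth_plus; [apply smooth_flat|easy]|].
  intros t; apply Rgt_not_eq, step_denominator.
Qed.

Lemma step_0 (x : R) : x <= 0 -> step x = 0.
Proof. intros H; unfold step; rewrite flat_nonpos by easy; unfold Rdiv; ring. Qed.

Lemma step_1 (x : R) : 1 <= x -> step x = 1.
Proof.
  intros H; unfold step; rewrite (flat_nonpos 0 (1 - x)) by lra.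
  pose proof (flat_pos 0 x); field; lra.
Qed.

Lemma step_bounds (x : R) : 0 <= step x <= 1.
Proof.
  pose proof (step_denominator x); pose proof (flat_nonneg 0 x);
    pose proof (flat_nonneg 0 (1 - x)).
  unfold step; split.
  - apply Rmult_le_pos; [easy|apply Rlt_le, Rinv_0_lt_compat; easy].
  - apply Rmult_le_reg_r with (flat 0 x + flat 0 (1 - x)); [easy|].
    replace (flat 0 x / (flat 0 x + flat 0 (1 - x)) * (flat 0 x + flat 0 (1 - x)))
      with (flat 0 x) by (field; lra); lra.
Qed.

(* Agrees with the identity on [2m, +oo) and is positive everywhere: replacing
   [x] by [clamp m x] inside roots and inverses makes integrands smooth on the
   whole plane without changing them near the curve under consideration. *)
Definition clamp (m x : R) : R := step (x / m - 1) * x + (1 - step (x / m - 1)) * m.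

(** For [x <= 0] the weight of [x] vanishes; for [x > 0] the value is a convex combination of two
    positive numbers. *)
Lemma clamp_pos (m x : R) : 0 < m -> 0 < clamp m x.
Proof.
  intros Hm; unfold clamp.
  destruct (Rle_dec x 0) as [H|H].
  - rewrite step_0; [lra|].
    assert (x / m <= 0); [|lra].
    unfold Rdiv; pose proof (Rinv_0_lt_compat m Hm); nra.
  - pose proof (step_bounds (x / m - 1)); set (s := step _) in *.
    destruct (Rle_dec s (1/2)); nra.
Qed.

Lemma clamp_id (m x : R) : 0 < m -> 2 * m <= x -> clamp m x = x.
Proof.
  intros Hm H; unfold clamp; rewrite step_1; [ring|].
  assert (2 <= x / m); [|lra].
  apply Rmult_le_reg_r with m; [easy|].
  replace (x / m * m) with x by (field; lra); lra.
Qed.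

Lemma smooth_clamp (m : R) : smooth (clamp m).
Proof.
  assert (H : smooth (fun x => step (x / m - 1))).
  { apply (smooth_comp step (fun x => x / m - 1)); [apply smooth_step|].
    apply smooth_minus; [|apply smooth_const].
    apply smooth_mult; [apply smooth_id|apply smooth_const]. }
  apply smooth_plus; apply smooth_mult; try easy; try apply smooth_id;
    try apply smooth_const.
  apply smooth_minus; [apply smooth_const|easy].
Qed.

Definition cinv (m x : R) : R := / clamp m x.
Definition csqrt (m x : R) : R := sqrt (clamp m x).

Lemma smooth_cinv (m : R) : 0 < m -> smooth (cinv m).
Proof.
  intros Hm; apply smooth_inv; [apply smooth_clamp|].
  intros t; now apply Rgt_not_eq, clamp_pos.
Qed.

Lemma smooth_csqrt (m : R) : 0 < m -> smooth (csqrt m).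
Proof.
  intros Hm; apply smooth_sqrt; [apply smooth_clamp|].
  intros t; now apply clamp_pos.
Qed.

Lemma cinv_eq (m x : R) : 0 < m -> 2 * m <= x -> cinv m x = / x.
Proof. intros; unfold cinv; now rewrite clamp_id. Qed.

Lemma csqrt_eq (m x : R) : 0 < m -> 2 * m <= x -> csqrt m x = sqrt x.
Proof. intros; unfold csqrt; now rewrite clamp_id. Qed.

Lemma csqrt_pos (m x : R) : 0 < m -> 0 < csqrt m x.
Proof. intros; now apply sqrt_lt_R0, clamp_pos. Qed.

(** * Smooth functions of two variables *)

Definition d1 (f : R -> R -> R) : R -> R -> R := fun e t => Derive (fun z => f z t) e.
Definition d2 (f : R -> R -> R) : R -> R -> R := fun e t => Derive (fun z => f e z) t.

Definition Ck2 (n : nat) (f : R -> R -> R) : Prop := forall e t, ex_diff_n f n e t.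

Lemma Ck2_S_iff (n : nat) (f : R -> R -> R) :
  Ck2 (S n) f <->
  (forall e t, continuity_2d_pt f e t) /\
  (forall e t, ex_derive (fun z => f z t) e) /\
  (forall e t, ex_derive (fun z => f e z) t) /\
  Ck2 n (d1 f) /\ Ck2 n (d2 f).
Proof.
  split.
  - intros H; repeat split; intros e t; apply (H e t).
  - intros (H1 & H2 & H3 & H4 & H5) e t; simpl; repeat split; auto.
Qed.

Lemma Ck2_continuous (n : nat) (f : R -> R -> R) (e t : R) :
  Ck2 n f -> continuity_2d_pt f e t.
Proof. intros H; destruct n; apply (H e t). Qed.

Lemma Ck2_S (n : nat) (f : R -> R -> R) : Ck2 (S n) f -> Ck2 n f.
Proof.
  revert f; induction n as [|n IH]; intros f H.
  - intros e t; split; [apply (H e t)|easy].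
  - apply Ck2_S_iff in H; destruct H as (H1 & H2 & H3 & H4 & H5).
    apply Ck2_S_iff; repeat split; auto.
Qed.

Lemma smooth2_continuous (f : R -> R -> R) (e t : R) :
  smooth2 f -> continuity_2d_pt f e t.
Proof. intros H; apply (Ck2_continuous 0); exact (H 0%nat). Qed.

Lemma smooth2_ex_d1 (f : R -> R -> R) (e t : R) :
  smooth2 f -> ex_derive (fun z => f z t) e.
Proof. intros H; apply (H 1%nat e t). Qed.

Lemma smooth2_ex_d2 (f : R -> R -> R) (e t : R) :
  smooth2 f -> ex_derive (fun z => f e z) t.
Proof. intros H; apply (H 1%nat e t). Qed.

Lemma smooth2_d1 (f : R -> R -> R) : smooth2 f -> smooth2 (d1 f).
Proof. intros H n e t; apply (H (S n) e t). Qed.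

Lemma smooth2_d2 (f : R -> R -> R) : smooth2 f -> smooth2 (d2 f).
Proof. intros H n e t; apply (H (S n) e t). Qed.

Lemma smooth2_slice (f : R -> R -> R) (e : R) : smooth2 f -> smooth (f e).
Proof.
  intros H; apply smooth_Ck; intros n; revert f H; induction n as [|n IH];
    intros f H; [easy|].
  split; [intros t; now apply (smooth2_ex_d2 f)|].
  exact (IH (d2 f) (smooth2_d2 f H)).
Qed.

Lemma Ck2_const (n : nat) (c : R) : Ck2 n (fun _ _ => c).
Proof.
  revert c; induction n as [|n IH]; intros c.
  - intros e t; split; [apply continuity_2d_pt_const|easy].
  - apply Ck2_S_iff; split; [|split; [|split; [|split]]].
    + intros e t; apply continuity_2d_pt_const.
    + intros e t; apply ex_derive_const.
    + intros e t; apply ex_derive_const.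
    + replace (d1 (fun _ _ => c)) with (fun _ _ : R => 0); [apply IH|].
      unfold d1; extensionality e; extensionality t; now rewrite Derive_const.
    + replace (d2 (fun _ _ => c)) with (fun _ _ : R => 0); [apply IH|].
      unfold d2; extensionality e; extensionality t; now rewrite Derive_const.
Qed.

Lemma Ck2_plus (n : nat) (f g : R -> R -> R) :
  Ck2 n f -> Ck2 n g -> Ck2 n (fun e t => f e t + g e t).
Proof.
  revert f g; induction n as [|n IH]; intros f g Hf Hg.
  - intros e t; split; [|easy].
    apply continuity_2d_pt_plus; [apply (Hf e t)|apply (Hg e t)].
  - apply Ck2_S_iff in Hf, Hg.
    destruct Hf as (F1 & F2 & F3 & F4 & F5), Hg as (G1 & G2 & G3 & G4 & G5).
    apply Ck2_S_iff; split; [|split; [|split; [|split]]].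
    + intros e t; now apply continuity_2d_pt_plus.
    + intros e t; apply (ex_derive_plus (fun z => f z t) (fun z => g z t)); auto.
    + intros e t; apply (ex_derive_plus (fun z => f e z) (fun z => g e z)); auto.
    + replace (d1 _) with (fun e t => d1 f e t + d1 g e t); [now apply IH|].
      unfold d1; extensionality e; extensionality t; rewrite Derive_plus; auto.
    + replace (d2 _) with (fun e t => d2 f e t + d2 g e t); [now apply IH|].
      unfold d2; extensionality e; extensionality t; rewrite Derive_plus; auto.
Qed.

Lemma Ck2_mult (n : nat) (f g : R -> R -> R) :
  Ck2 n f -> Ck2 n g -> Ck2 n (fun e t => f e t * g e t).
Proof.
  revert f g; induction n as [|n IH]; intros f g Hf Hg.
  - intros e t; split; [|easy].
    apply continuity_2d_pt_mult; [apply (Hf e t)|apply (Hg e t)].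
  - pose proof (Ck2_S _ _ Hf) as Hf0; pose proof (Ck2_S _ _ Hg) as Hg0.
    apply Ck2_S_iff in Hf, Hg.
    destruct Hf as (F1 & F2 & F3 & F4 & F5), Hg as (G1 & G2 & G3 & G4 & G5).
    apply Ck2_S_iff; split; [|split; [|split; [|split]]].
    + intros e t; now apply continuity_2d_pt_mult.
    + intros e t; apply (ex_derive_mult (fun z => f z t) (fun z => g z t)); auto.
    + intros e t; apply (ex_derive_mult (fun z => f e z) (fun z => g e z)); auto.
    + replace (d1 _) with (fun e t => d1 f e t * g e t + f e t * d1 g e t);
        [apply Ck2_plus; now apply IH|].
      unfold d1; extensionality e; extensionality t; rewrite Derive_mult; auto.
    + replace (d2 _) with (fun e t => d2 f e t * g e t + f e t * d2 g e t);
        [apply Ck2_plus; now apply IH|].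
      unfold d2; extensionality e; extensionality t; rewrite Derive_mult; auto.
Qed.

Lemma continuity_2d_comp1 (h : R -> R) (f : R -> R -> R) (e t : R) :
  smooth h -> continuity_2d_pt f e t -> continuity_2d_pt (fun e t => h (f e t)) e t.
Proof.
  intros Hh Hf; apply continuity_1d_2d_pt_comp; [|easy].
  apply continuity_pt_filterlim, (smooth_continuous h _ Hh).
Qed.

Lemma Ck2_comp1 (n : nat) (h : R -> R) (f : R -> R -> R) :
  smooth h -> Ck2 n f -> Ck2 n (fun e t => h (f e t)).
Proof.
  revert h f; induction n as [|n IH]; intros h f Hh Hf.
  - intros e t; split; [|easy]; apply continuity_2d_comp1; [easy|apply (Hf e t)].
  - pose proof (Ck2_S _ _ Hf) as Hf0.
    pose proof (fun x => smooth_ex_derive h x Hh) as Hd.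
    apply Ck2_S_iff in Hf; destruct Hf as (F1 & F2 & F3 & F4 & F5).
    apply Ck2_S_iff; split; [|split; [|split; [|split]]].
    + intros e t; now apply continuity_2d_comp1.
    + intros e t; apply (ex_derive_comp h (fun z => f z t)); auto.
    + intros e t; apply (ex_derive_comp h (fun z => f e z)); auto.
    + replace (d1 _) with (fun e t => d1 f e t * Derive h (f e t));
        [apply Ck2_mult; [easy|]; apply IH; [now apply smooth_Derive|easy]|].
      unfold d1; extensionality e; extensionality t; rewrite (Derive_comp h (fun z => f z t)); auto.
    + replace (d2 _) with (fun e t => d2 f e t * Derive h (f e t));
        [apply Ck2_mult; [easy|]; apply IH; [now apply smooth_Derive|easy]|].
      unfold d2; extensionality e; extensionality t; rewrite (Derive_comp h (fun z => f e z)); auto.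
Qed.

Lemma smooth2_const (c : R) : smooth2 (fun _ _ => c).
Proof. intros n; apply Ck2_const. Qed.

Lemma smooth2_plus (f g : R -> R -> R) :
  smooth2 f -> smooth2 g -> smooth2 (fun e t => f e t + g e t).
Proof. intros Hf Hg n; apply Ck2_plus; [exact (Hf n)|exact (Hg n)]. Qed.

Lemma smooth2_mult (f g : R -> R -> R) :
  smooth2 f -> smooth2 g -> smooth2 (fun e t => f e t * g e t).
Proof. intros Hf Hg n; apply Ck2_mult; [exact (Hf n)|exact (Hg n)]. Qed.

Lemma smooth2_comp1 (h : R -> R) (f : R -> R -> R) :
  smooth h -> smooth2 f -> smooth2 (fun e t => h (f e t)).
Proof. intros Hh Hf n; apply Ck2_comp1; [easy|exact (Hf n)]. Qed.

Lemma smooth2_opp (f : R -> R -> R) : smooth2 f -> smooth2 (fun e t => - f e t).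
Proof.
  intros H; replace (fun e t => - f e t) with (fun e t => (-1) * f e t).
  - apply smooth2_mult; [apply smooth2_const|easy].
  - extensionality e; extensionality t; ring.
Qed.

Lemma smooth2_minus (f g : R -> R -> R) :
  smooth2 f -> smooth2 g -> smooth2 (fun e t => f e t - g e t).
Proof. intros Hf Hg; apply smooth2_plus; [easy|]; now apply smooth2_opp. Qed.

Lemma smooth2_snd (h : R -> R) : smooth h -> smooth2 (fun _ t => h t).
Proof.
  intros Hh; apply (smooth2_comp1 h (fun _ t => t) Hh).
  intros [|n].
  - intros e t; split; [apply continuity_2d_pt_id2|easy].
  - apply Ck2_S_iff; split; [|split; [|split; [|split]]].
    + intros e t; apply continuity_2d_pt_id2.
    + intros e t; apply ex_derive_const.
    + intros e t; apply ex_derive_id.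
    + replace (d1 _) with (fun _ _ : R => 0); [apply Ck2_const|].
      unfold d1; extensionality e; extensionality t; now rewrite Derive_const.
    + replace (d2 _) with (fun _ _ : R => 1); [apply Ck2_const|].
      unfold d2; extensionality e; extensionality t; now rewrite Derive_id.
Qed.

Lemma smooth2_fst (h : R -> R) : smooth h -> smooth2 (fun e _ => h e).
Proof.
  intros Hh; apply (smooth2_comp1 h (fun e _ => e) Hh).
  intros [|n].
  - intros e t; split; [apply continuity_2d_pt_id1|easy].
  - apply Ck2_S_iff; split; [|split; [|split; [|split]]].
    + intros e t; apply continuity_2d_pt_id1.
    + intros e t; apply ex_derive_id.
    + intros e t; apply ex_derive_const.
    + replace (d1 _) with (fun _ _ : R => 1); [apply Ck2_const|].
      unfold d1; extensionality e; extensionality t; now rewrite Derive_id.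
    + replace (d2 _) with (fun _ _ : R => 0); [apply Ck2_const|].
      unfold d2; extensionality e; extensionality t; now rewrite Derive_const.
Qed.

Lemma continuity_2d_reparam (f : R -> R -> R) (h : R -> R) (e t : R) :
  smooth2 f -> smooth h -> continuity_2d_pt (fun e t => f e (h t)) e t.
Proof.
  intros Hf Hh eps.
  destruct (smooth2_continuous f e (h t) Hf eps) as [d Hd].
  destruct (smooth2_continuous _ e t (smooth2_snd h Hh) d) as [d' Hd'].
  exists (mkposreal _ (Rmin_pos _ _ (cond_pos d) (cond_pos d'))); simpl.
  intros u v Hu Hv; apply Hd.
  - apply Rlt_le_trans with (1 := Hu), Rmin_l.
  - apply (Hd' e v).
    + rewrite Rminus_diag, Rabs_R0; apply cond_pos.
    + apply Rlt_le_trans with (1 := Hv), Rmin_r.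
Qed.

Lemma smooth2_reparam (f : R -> R -> R) (h : R -> R) :
  smooth2 f -> smooth h -> smooth2 (fun e t => f e (h t)).
Proof.
  intros Hf Hh n; change (Ck2 n (fun e t => f e (h t))).
  revert f Hf; induction n as [|n IH]; intros f Hf.
  - intros e t; split; [now apply continuity_2d_reparam|easy].
  - pose proof (fun x => smooth_ex_derive h x Hh) as Hd.
    apply Ck2_S_iff; split; [|split; [|split; [|split]]].
    + intros e t; now apply continuity_2d_reparam.
    + intros e t; now apply smooth2_ex_d1.
    + intros e t; apply (ex_derive_comp (f e) h); [now apply (smooth2_ex_d2 f)|easy].
    + exact (IH (d1 f) (smooth2_d1 f Hf)).
    + replace (d2 _) with (fun e t => Derive h t * d2 f e (h t)).
      * apply Ck2_mult; [|exact (IH (d2 f) (smooth2_d2 f Hf))].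
        exact (smooth2_snd _ (smooth_Derive h Hh) n).
      * unfold d2; extensionality e; extensionality t.
        rewrite (Derive_comp (f e) h); [easy|now apply (smooth2_ex_d2 f)|easy].
Qed.

(** All first variations below go through this form of differentiation under the integral sign; it
    asks for an integrand smooth in parameter and variable on the whole plane, which the clamped
    densities provide. *)
Lemma is_derive_RInt_smooth2 (f : R -> R -> R) (a b e : R) :
  smooth2 f ->
  is_derive (fun e => RInt (f e) a b) e (RInt (fun t => d1 f e t) a b).
Proof.
  intros H; apply (is_derive_RInt_param f a b e).
  - apply filter_forall; intros x t _; now apply smooth2_ex_d1.
  - intros t _; exact (smooth2_continuous _ e t (smooth2_d1 f H)).
  - apply filter_forall; intros x; apply smooth_ex_RInt; now apply smooth2_slice.
Qed.

Lemma is_derive_RInt_smooth (f : R -> R) (a t : R) :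
  smooth f -> is_derive (fun t => RInt f a t) t (f t).
Proof.
  intros H; apply (is_derive_RInt f (fun t => RInt f a t) a).
  - apply filter_forall; intros x; apply (RInt_correct f), smooth_ex_RInt, H.
  - now apply smooth_continuous.
Qed.

(** Move the parameter first, with the upper limit [t] kept, where differentiability in the
    parameter gives continuity. Then move the upper limit: the remaining integral from [t] to [v] is
    at most [M * Rabs (v - t)], as the integrand is bounded by [M] near the point. *)
Lemma continuity_2d_primitive (f : R -> R -> R) (e t : R) :
  smooth2 f -> continuity_2d_pt (fun e t => RInt (f e) 0 t) e t.
Proof.
  intros Hf eps.
  destruct (smooth2_continuous f e t Hf (mkposreal 1 Rlt_0_1)) as [d Hd]; simpl in Hd.
  set (M := Rabs (f e t) + 1).
  assert (HM : 0 < M) by (unfold M; pose proof (Rabs_pos (f e t)); lra).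
  assert (Hc : continuous (fun e => RInt (f e) 0 t) e).
  { apply (ex_derive_continuous (fun e => RInt (f e) 0 t)).
    eexists; now apply is_derive_RInt_smooth2. }
  assert (Heps : 0 < eps / 2) by (pose proof (cond_pos eps); lra).
  destruct (proj1 (filterlim_locally (F := locally e) _ _) Hc (mkposreal _ Heps)) as [d' Hd'].
  assert (Hr : 0 < Rmin (Rmin d d') (eps / (2 * M))).
  { apply Rmin_pos; [apply Rmin_pos; apply cond_pos|].
    apply Rdiv_lt_0_compat; [apply cond_pos|lra]. }
  exists (mkposreal _ Hr); simpl; intros u v Hu Hv.
  pose proof (Rmin_l (Rmin d d') (eps / (2 * M))).
  pose proof (Rmin_r (Rmin d d') (eps / (2 * M))).
  pose proof (Rmin_l d d'); pose proof (Rmin_r d d').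
  assert (B1 : Rabs (RInt (f u) 0 t - RInt (f e) 0 t) < eps / 2).
  { apply (Hd' u); unfold ball; simpl; unfold AbsRing_ball, abs, minus, plus, opp; simpl.
    change (Rabs (u - e) < d'); lra. }
  assert (B2 : Rabs (RInt (f u) t v) <= M * Rabs (v - t)).
  { destruct (Rle_dec t v) as [Htv|Htv].
    - rewrite (Rabs_pos_eq (v - t)) by lra; rewrite Rmult_comm.
      apply abs_RInt_le_const; [easy|apply smooth_ex_RInt, smooth2_slice, Hf|].
      intros x Hx; unfold M.
      assert (Hx' : Rabs (f u x - f e t) < 1).
      { apply Hd; [lra|]; apply Rle_lt_trans with (Rabs (v - t)); [|lra].
        rewrite !Rabs_pos_eq; lra. }
      pose proof (Rabs_triang_inv (f u x) (f e t)); lra.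
    - rewrite <- opp_RInt_swap by apply smooth_ex_RInt, smooth2_slice, Hf.
      change (Rabs (- RInt (f u) v t) <= M * Rabs (v - t)); rewrite Rabs_Ropp.
      rewrite (Rabs_left (v - t)) by lra; rewrite Rmult_comm.
      replace (- (v - t)) with (t - v) by ring.
      apply abs_RInt_le_const; [lra|apply smooth_ex_RInt, smooth2_slice, Hf|].
      intros x Hx; unfold M.
      assert (Hx' : Rabs (f u x - f e t) < 1).
      { apply Hd; [lra|]; apply Rle_lt_trans with (Rabs (v - t)); [|lra].
        rewrite (Rabs_left (v - t)) by lra; apply Rabs_le; lra. }
      pose proof (Rabs_triang_inv (f u x) (f e t)); lra. }
  assert (B3 : M * Rabs (v - t) < eps / 2).
  { apply Rlt_le_trans with (M * (eps / (2 * M))).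
    - apply Rmult_lt_compat_l; lra.
    - right; field; lra. }
  rewrite <- (RInt_Chasles (f u) 0 t v) by (apply smooth_ex_RInt, smooth2_slice, Hf).
  change (plus (RInt (f u) 0 t) (RInt (f u) t v)) with (RInt (f u) 0 t + RInt (f u) t v).
  replace (RInt (f u) 0 t + RInt (f u) t v - RInt (f e) 0 t)
    with (RInt (f u) 0 t - RInt (f e) 0 t + RInt (f u) t v) by ring.
  apply Rle_lt_trans with (1 := Rabs_triang _ _); lra.
Qed.

Lemma smooth2_primitive (f : R -> R -> R) :
  smooth2 f -> smooth2 (fun e t => RInt (f e) 0 t).
Proof.
  intros Hf n; change (Ck2 n (fun e t => RInt (f e) 0 t)).
  revert f Hf; induction n as [|n IH]; intros f Hf.
  - intros e t; split; [now apply continuity_2d_primitive|easy].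
  - apply Ck2_S_iff; split; [|split; [|split; [|split]]].
    + intros e t; now apply continuity_2d_primitive.
    + intros e t; eexists; now apply is_derive_RInt_smooth2.
    + intros e t; eexists; apply is_derive_RInt_smooth; now apply smooth2_slice.
    + replace (d1 _) with (fun e t => RInt (d1 f e) 0 t); [apply IH; now apply smooth2_d1|].
      unfold d1 at 2; extensionality e; extensionality t; symmetry.
      apply is_derive_unique; now apply is_derive_RInt_smooth2.
    + replace (d2 _) with f; [exact (Hf n)|].
      unfold d2; extensionality e; extensionality t; symmetry.
      apply is_derive_unique, is_derive_RInt_smooth; now apply smooth2_slice.
Qed.

Lemma smooth_primitive (f : R -> R) : smooth f -> smooth (fun t => RInt f 0 t).
Proof.
  intros H; apply (smooth_of_Derive _ f); [|easy].
  intros t; now apply is_derive_RInt_smooth.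
Qed.

(** * Geometry of curves in terms of the derivatives *)

Lemma R3_ext (u v : R3) : X1 u = X1 v -> X2 u = X2 v -> X3 u = X3 v -> u = v.
Proof.
  destruct u as [[a b] c], v as [[a' b'] c']; unfold X1, X2, X3; simpl; congruence.
Qed.

Lemma X1_plus (u v : R3) : X1 (plus u v) = X1 u + X1 v. Proof. reflexivity. Qed.
Lemma X2_plus (u v : R3) : X2 (plus u v) = X2 u + X2 v. Proof. reflexivity. Qed.
Lemma X3_plus (u v : R3) : X3 (plus u v) = X3 u + X3 v. Proof. reflexivity. Qed.
Lemma X1_minus (u v : R3) : X1 (minus u v) = X1 u - X1 v. Proof. reflexivity. Qed.
Lemma X2_minus (u v : R3) : X2 (minus u v) = X2 u - X2 v. Proof. reflexivity. Qed.
Lemma X3_minus (u v : R3) : X3 (minus u v) = X3 u - X3 v. Proof. reflexivity. Qed.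
Lemma X1_scal (a : R) (v : R3) : X1 (scal a v) = a * X1 v. Proof. reflexivity. Qed.
Lemma X2_scal (a : R) (v : R3) : X2 (scal a v) = a * X2 v. Proof. reflexivity. Qed.
Lemma X3_scal (a : R) (v : R3) : X3 (scal a v) = a * X3 v. Proof. reflexivity. Qed.
Lemma X1_cross (u v : R3) : X1 (cross u v) = X2 u * X3 v - X3 u * X2 v. Proof. reflexivity. Qed.
Lemma X2_cross (u v : R3) : X2 (cross u v) = X3 u * X1 v - X1 u * X3 v. Proof. reflexivity. Qed.
Lemma X3_cross (u v : R3) : X3 (cross u v) = X1 u * X2 v - X2 u * X1 v. Proof. reflexivity. Qed.

Ltac r3_simpl :=
  unfold dot in *;
  repeat rewrite ?X1_plus, ?X2_plus, ?X3_plus, ?X1_minus, ?X2_minus, ?X3_minus,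
    ?X1_scal, ?X2_scal, ?X3_scal, ?X1_cross, ?X2_cross, ?X3_cross.

Definition det3 (u v w : R3) : R := dot w (cross u v).

(* Squared speed, squared area spanned by the first two derivatives, and volume
   spanned by the first three. *)
Definition gram1 (g : R -> R3) (t : R) : R := dot (D g t) (D g t).
Definition gram2 (g : R -> R3) (t : R) : R :=
  dot (cross (D g t) (D (D g) t)) (cross (D g t) (D (D g) t)).
Definition triple (g : R -> R3) (t : R) : R :=
  det3 (D g t) (D (D g) t) (D (D (D g)) t).

Lemma dot_nonneg (u : R3) : 0 <= dot u u.
Proof. unfold dot; nra. Qed.

Lemma norm3_pos_iff (u : R3) : 0 < norm3 u <-> 0 < dot u u.
Proof.
  unfold norm3; split; intros H.
  - destruct (Rle_lt_or_eq_dec _ _ (dot_nonneg u)) as [H0|H0]; [easy|].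
    rewrite <- H0, sqrt_0 in H; lra.
  - now apply sqrt_lt_R0.
Qed.

Definition diff_curve (c : R -> R3) (t : R) : Prop :=
  ex_derive (fun u => X1 (c u)) t /\ ex_derive (fun u => X2 (c u)) t /\
  ex_derive (fun u => X3 (c u)) t.

Lemma smooth_curve_diff (c : R -> R3) (t : R) : smooth_curve c -> diff_curve c t.
Proof. intros (H1 & H2 & H3); repeat split; now apply smooth_ex_derive. Qed.

Lemma smooth_curve_D (c : R -> R3) : smooth_curve c -> smooth_curve (D c).
Proof. intros (H1 & H2 & H3); repeat split; now apply smooth_Derive. Qed.

Lemma smooth_curve_const (u : R3) : smooth_curve (fun _ => u).
Proof. repeat split; apply smooth_const. Qed.

Lemma smooth_curve_scal (a : R -> R) (c : R -> R3) :
  smooth a -> smooth_curve c -> smooth_curve (fun t => scal (a t) (c t)).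
Proof.
  intros Ha (H1 & H2 & H3); split; [|split].
  - exact (smooth_mult _ _ Ha H1).
  - exact (smooth_mult _ _ Ha H2).
  - exact (smooth_mult _ _ Ha H3).
Qed.

Lemma smooth_curve_plus (c c' : R -> R3) :
  smooth_curve c -> smooth_curve c' -> smooth_curve (fun t => plus (c t) (c' t)).
Proof.
  intros (H1 & H2 & H3) (H1' & H2' & H3'); split; [|split].
  - exact (smooth_plus _ _ H1 H1').
  - exact (smooth_plus _ _ H2 H2').
  - exact (smooth_plus _ _ H3 H3').
Qed.

Lemma smooth_curve_comp (c : R -> R3) (h : R -> R) :
  smooth_curve c -> smooth h -> smooth_curve (fun t => c (h t)).
Proof.
  intros (H1 & H2 & H3) Hh; split; [|split].
  - exact (smooth_comp _ _ H1 Hh).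
  - exact (smooth_comp _ _ H2 Hh).
  - exact (smooth_comp _ _ H3 Hh).
Qed.

Lemma smooth_dot (c c' : R -> R3) :
  smooth_curve c -> smooth_curve c' -> smooth (fun t => dot (c t) (c' t)).
Proof.
  intros (H1 & H2 & H3) (H1' & H2' & H3').
  apply smooth_plus; [apply smooth_plus|]; now apply smooth_mult.
Qed.

Lemma smooth_cross (c c' : R -> R3) :
  smooth_curve c -> smooth_curve c' -> smooth_curve (fun t => cross (c t) (c' t)).
Proof.
  intros (H1 & H2 & H3) (H1' & H2' & H3'); split; [|split];
  apply smooth_minus; now apply smooth_mult.
Qed.

Lemma smooth_gram1 (g : R -> R3) : smooth_curve g -> smooth (gram1 g).
Proof. intros H; apply smooth_dot; now apply smooth_curve_D. Qed.

Lemma smooth_gram2 (g : R -> R3) : smooth_curve g -> smooth (gram2 g).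
Proof.
  intros H; assert (H1 := smooth_curve_D _ H); assert (H2 := smooth_curve_D _ H1).
  apply smooth_dot; now apply smooth_cross.
Qed.

Lemma smooth_triple (g : R -> R3) : smooth_curve g -> smooth (triple g).
Proof.
  intros H; assert (H1 := smooth_curve_D _ H); assert (H2 := smooth_curve_D _ H1).
  apply smooth_dot; [now apply smooth_curve_D|now apply smooth_cross].
Qed.

Lemma D_ext_loc (c c' : R -> R3) (t : R) :
  locally t (fun u => c u = c' u) -> D c t = D c' t.
Proof.
  intros H; unfold D; f_equal; [f_equal|]; apply Derive_ext_loc;
    apply filter_imp with (2 := H); intros u Hu; now rewrite Hu.
Qed.

Lemma locally_D_ext (c c' : R -> R3) (t : R) :
  locally t (fun u => c u = c' u) -> locally t (fun u => D c u = D c' u).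
Proof.
  intros H; apply filter_imp with (2 := locally_locally _ _ H).
  intros u; apply D_ext_loc.
Qed.

Lemma D_scal (a : R -> R) (c : R -> R3) (t : R) :
  ex_derive a t -> diff_curve c t ->
  D (fun u => scal (a u) (c u)) t
  = plus (scal (Derive a t) (c t)) (scal (a t) (D c t)).
Proof.
  intros Ha (H1 & H2 & H3); apply R3_ext; r3_simpl.
  - exact (Derive_mult a (fun u => X1 (c u)) t Ha H1).
  - exact (Derive_mult a (fun u => X2 (c u)) t Ha H2).
  - exact (Derive_mult a (fun u => X3 (c u)) t Ha H3).
Qed.

Lemma D_plus (c c' : R -> R3) (t : R) :
  diff_curve c t -> diff_curve c' t ->
  D (fun u => plus (c u) (c' u)) t = plus (D c t) (D c' t).
Proof.
  intros (H1 & H2 & H3) (H1' & H2' & H3'); apply R3_ext; r3_simpl.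
  - exact (Derive_plus (fun u => X1 (c u)) (fun u => X1 (c' u)) t H1 H1').
  - exact (Derive_plus (fun u => X2 (c u)) (fun u => X2 (c' u)) t H2 H2').
  - exact (Derive_plus (fun u => X3 (c u)) (fun u => X3 (c' u)) t H3 H3').
Qed.

Lemma D_comp (c : R -> R3) (h : R -> R) (t : R) :
  ex_derive h t -> diff_curve c (h t) ->
  D (fun u => c (h u)) t = scal (Derive h t) (D c (h t)).
Proof.
  intros Hh (H1 & H2 & H3); apply R3_ext.
  - exact (Derive_comp (fun u => X1 (c u)) h t H1 Hh).
  - exact (Derive_comp (fun u => X2 (c u)) h t H2 Hh).
  - exact (Derive_comp (fun u => X3 (c u)) h t H3 Hh).
Qed.

Lemma Derive_dot (c c' : R -> R3) (t : R) :
  diff_curve c t -> diff_curve c' t ->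
  Derive (fun u => dot (c u) (c' u)) t = dot (D c t) (c' t) + dot (c t) (D c' t).
Proof.
  assert (H : forall a1 a2 a3 b1 b2 b3 : R -> R,
    ex_derive a1 t -> ex_derive a2 t -> ex_derive a3 t ->
    ex_derive b1 t -> ex_derive b2 t -> ex_derive b3 t ->
    Derive (fun u => a1 u * b1 u + a2 u * b2 u + a3 u * b3 u) t
    = (Derive a1 t * b1 t + Derive a2 t * b2 t + Derive a3 t * b3 t)
      + (a1 t * Derive b1 t + a2 t * Derive b2 t + a3 t * Derive b3 t)).
  { intros; apply is_derive_unique; auto_derive; [now repeat split|].
    repeat match goal with |- context [Derive (fun x => ?f x) t] =>
      change (Derive (fun x => f x) t) with (Derive f t) end; ring. }
  intros (H1 & H2 & H3) (H1' & H2' & H3').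
  exact (H _ _ _ _ _ _ H1 H2 H3 H1' H2' H3').
Qed.

Lemma D_cross (c c' : R -> R3) (t : R) :
  diff_curve c t -> diff_curve c' t ->
  D (fun u => cross (c u) (c' u)) t = plus (cross (D c t) (c' t)) (cross (c t) (D c' t)).
Proof.
  assert (H : forall a1 a2 b1 b2 : R -> R,
    ex_derive a1 t -> ex_derive a2 t -> ex_derive b1 t -> ex_derive b2 t ->
    Derive (fun u => a1 u * b2 u - a2 u * b1 u) t
    = (Derive a1 t * b2 t - Derive a2 t * b1 t)
      + (a1 t * Derive b2 t - a2 t * Derive b1 t)).
  { intros; apply is_derive_unique; auto_derive; [now repeat split|].
    repeat match goal with |- context [Derive (fun x => ?f x) t] =>
      change (Derive (fun x => f x) t) with (Derive f t) end; ring. }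
  intros (H1 & H2 & H3) (H1' & H2' & H3'); apply R3_ext.
  - exact (H _ _ _ _ H2 H3 H2' H3').
  - exact (H _ _ _ _ H3 H1 H3' H1').
  - exact (H _ _ _ _ H1 H2 H1' H2').
Qed.

Lemma locally_imp2 (P Q S : R -> Prop) (t : R) :
  (forall u, P u -> Q u -> S u) -> locally t P -> locally t Q -> locally t S.
Proof.
  intros H HP HQ; apply filter_imp with (2 := filter_and _ _ HP HQ).
  intros u [Hu Hu']; auto.
Qed.

Lemma continuous_locally_gt (f : R -> R) (t m : R) :
  continuous f t -> m < f t -> locally t (fun u => m < f u).
Proof.
  intros Hf Hm; apply Hf.
  apply (open_gt m (f t) Hm).
Qed.

Lemma locally_Ioo (a b t : R) : a < t < b -> locally t (fun u => a < u < b).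
Proof.
  intros [H1 H2]; apply filter_and; [apply (open_gt a t H1)|apply (open_lt b t H2)].
Qed.

(** The inverse norm is smooth only away from the zeros of [c]. Since [D] is local, a globally
    smooth function that agrees with it near [t] is enough for the product rules. The threshold [m]
    is a quarter of the squared norm at [t], so that [2 * m] lies strictly below that value. *)
Lemma normalizer (c : R -> R3) (t : R) :
  smooth_curve c -> 0 < dot (c t) (c t) ->
  exists i, smooth i /\ locally t (fun u => / norm3 (c u) = i u).
Proof.
  intros Hc H.
  set (m := dot (c t) (c t) / 4).
  assert (Hm : 0 < m) by (unfold m; lra).
  exists (fun u => / csqrt m (dot (c u) (c u))).
  assert (Hs := smooth_dot c c Hc Hc).
  split.
  - apply smooth_inv.
    + apply (smooth_comp (csqrt m)); [now apply smooth_csqrt|easy].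
    + intros u; now apply Rgt_not_eq, csqrt_pos.
  - assert (H2 : 2 * m < dot (c t) (c t)) by (unfold m; lra).
    generalize (continuous_locally_gt _ t _ (smooth_continuous _ t Hs) H2).
    apply filter_imp; intros u Hu; rewrite csqrt_eq; [easy|easy|lra].
Qed.

Lemma unit_orthogonal (c : R -> R3) (t : R) :
  diff_curve c t -> locally t (fun u => dot (c u) (c u) = 1) -> dot (c t) (D c t) = 0.
Proof.
  intros Hc H.
  pose proof (Derive_dot c c t Hc Hc) as Hd.
  rewrite (Derive_ext_loc _ (fun _ => 1)), Derive_const in Hd by easy.
  assert (dot (D c t) (c t) = dot (c t) (D c t)) by (unfold dot; ring); lra.
Qed.

Lemma lagrange_identity (u v : R3) :
  dot (cross u v) (cross u v) = dot u u * dot v v - dot u v * dot u v.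
Proof. r3_simpl; ring. Qed.

Lemma norm3_inv_scal (u : R3) :
  0 < dot u u -> dot (scal (/ norm3 u) u) (scal (/ norm3 u) u) = 1.
Proof.
  intros H; assert (Hn := proj2 (norm3_pos_iff u) H).
  replace (dot (scal (/ norm3 u) u) (scal (/ norm3 u) u))
    with (/ norm3 u * / norm3 u * dot u u) by (r3_simpl; ring).
  replace (dot u u) with (norm3 u * norm3 u) by (apply sqrt_def; lra).
  field; lra.
Qed.

Section Frenet.

Variables (g : R -> R3) (t : R).
Hypothesis Hg : smooth_curve g.
Hypothesis HA : 0 < gram1 g t.

Let tangent_aux : exists i, smooth i /\ i t = / sqrt (gram1 g t) /\
  locally t (fun u => tangent g u = scal (i u) (D g u)) /\
  locally t (fun u => dot (scal (i u) (D g u)) (scal (i u) (D g u)) = 1).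
Proof.
  destruct (normalizer (D g) t (smooth_curve_D _ Hg) HA) as (i & Hi & Hloc).
  exists i; split; [easy|]; split; [|split].
  - symmetry; exact (locally_singleton _ _ Hloc).
  - apply filter_imp with (2 := Hloc); intros u Hu.
    unfold tangent, speed; now rewrite Hu.
  - generalize (continuous_locally_gt _ t 0
      (smooth_continuous _ t (smooth_gram1 g Hg)) HA).
    generalize Hloc; apply locally_imp2; intros u Hu Hp.
    rewrite <- Hu; now apply norm3_inv_scal.
Qed.

Let velocity_scal (i : R -> R) (u : R) : smooth i ->
  D (fun u => scal (i u) (D g u)) u
  = plus (scal (Derive i u) (D g u)) (scal (i u) (D (D g) u)).
Proof.
  intros Hi; apply D_scal; [now apply smooth_ex_derive|].
  apply smooth_curve_diff, smooth_curve_D, Hg.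
Qed.

(** As [T] is a unit vector orthogonal to [T'], the norms of [T'] and [T x T'] agree. In the cross
    product the part of [T'] along [g'] drops out, leaving [i^2 g' x g'']. *)
Let dtangent_sq (i : R -> R) : smooth i -> i t = / sqrt (gram1 g t) ->
  locally t (fun u => dot (scal (i u) (D g u)) (scal (i u) (D g u)) = 1) ->
  let T := fun u => scal (i u) (D g u) in
  dot (D T t) (D T t) = gram2 g t / (gram1 g t * gram1 g t).
Proof.
  intros Hi Hit Hunit T.
  assert (HT : smooth_curve T) by (apply smooth_curve_scal; [|apply smooth_curve_D]; easy).
  pose proof (unit_orthogonal T t (smooth_curve_diff T t HT) Hunit) as Ho.
  pose proof (lagrange_identity (T t) (D T t)) as Hl.
  rewrite Ho in Hl.
  replace (dot (T t) (T t)) with 1 in Hl by (symmetry; exact (locally_singleton _ _ Hunit)).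
  rewrite !Rmult_0_l, Rmult_1_l, Rminus_0_r in Hl; rewrite <- Hl.
  unfold T; rewrite velocity_scal by easy.
  replace (cross (scal (i t) (D g t))
             (plus (scal (Derive i t) (D g t)) (scal (i t) (D (D g) t))))
    with (scal (i t * i t) (cross (D g t) (D (D g) t)))
    by (apply R3_ext; r3_simpl; ring).
  rewrite Hit.
  assert (Hs := sqrt_lt_R0 _ HA).
  replace (gram1 g t * gram1 g t)
    with (sqrt (gram1 g t) * sqrt (gram1 g t) * (sqrt (gram1 g t) * sqrt (gram1 g t)))
    by (rewrite sqrt_def; lra).
  unfold gram2; set (w := cross _ _); r3_simpl; field; lra.
Qed.

Lemma curvature_eq : curvature g t = sqrt (gram2 g t) / (gram1 g t * sqrt (gram1 g t)).
Proof.
  destruct tangent_aux as (i & Hi & Hit & Hloc & Hunit).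
  pose proof (dtangent_sq i Hi Hit Hunit) as Hsq; simpl in Hsq.
  unfold curvature.
  rewrite (D_ext_loc _ (fun u => scal (i u) (D g u)) _ Hloc); unfold norm3.
  rewrite Hsq.
  rewrite sqrt_div_alt by nra; rewrite sqrt_square by lra.
  change (speed g t) with (sqrt (gram1 g t)).
  assert (Hs := sqrt_lt_R0 _ HA); field; lra.
Qed.

(** With [T = i g'] and [N = j T'] near [t], the product [<N', T x N>] is [j^2 det(T, T', T'')]. The
    determinant is alternating, so all derivatives of [i] and [j] cancel and
    [j^2 i^3 det(g', g'', g''')] remains. *)
Lemma modified_torsion_eq : 0 < gram2 g t ->
  modified_torsion g t
  = triple g t * (gram1 g t * sqrt (gram1 g t)) / (gram2 g t * sqrt (gram2 g t)).
Proof.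
  intros HB; unfold modified_torsion, torsion; rewrite curvature_eq.
  destruct tangent_aux as (i & Hi & Hit & Hloc & Hunit).
  assert (Hs1 := sqrt_lt_R0 _ HA); assert (Hs2 := sqrt_lt_R0 _ HB).
  set (T := fun u => scal (i u) (D g u)) in *.
  assert (HT : smooth_curve T) by (apply smooth_curve_scal; [|apply smooth_curve_D]; easy).
  assert (HDT := smooth_curve_D T HT).
  pose proof (dtangent_sq i Hi Hit Hunit) as Hsq; simpl in Hsq; fold T in Hsq.
  assert (Hpos : 0 < dot (D T t) (D T t))
    by (rewrite Hsq; apply Rdiv_lt_0_compat; [easy|nra]).
  destruct (normalizer (D T) t HDT Hpos) as (j & Hj & Hjloc).
  assert (Hjt : j t = gram1 g t / sqrt (gram2 g t)).
  { rewrite <- (locally_singleton _ _ Hjloc); unfold norm3; rewrite Hsq.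
    rewrite sqrt_div_alt by nra; rewrite sqrt_square by lra; field; lra. }
  assert (HN : locally t (fun u => normal g u = scal (j u) (D T u))).
  { generalize Hjloc (locally_D_ext _ _ _ Hloc); apply locally_imp2; intros u Hu Hu'.
    unfold normal; rewrite Hu'; f_equal; exact Hu. }
  unfold binormal; rewrite (D_ext_loc _ _ _ HN), (locally_singleton _ _ HN).
  rewrite (locally_singleton _ _ Hloc).
  rewrite D_scal by (try apply smooth_ex_derive, Hj; apply smooth_curve_diff, HDT).
  rewrite (D_ext_loc (D T)
    (fun u => plus (scal (Derive i u) (D g u)) (scal (i u) (D (D g) u))))
    by (apply filter_forall; intros u; now apply velocity_scal).
  assert (Hg1 := smooth_curve_D g Hg); assert (Hg2 := smooth_curve_D _ Hg1).
  assert (Hi' := smooth_Derive i Hi).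
  rewrite D_plus by (now apply smooth_curve_diff, smooth_curve_scal).
  rewrite !D_scal by (try apply smooth_ex_derive; try apply smooth_curve_diff; easy).
  replace (D T t) with (plus (scal (Derive i t) (D g t)) (scal (i t) (D (D g) t)))
    by (symmetry; now apply velocity_scal).
  transitivity (j t * j t * (i t * i t * i t) * triple g t / speed g t
                / (sqrt (gram2 g t) / (gram1 g t * sqrt (gram1 g t)))).
  - f_equal; f_equal.
    unfold triple, det3; r3_simpl; ring.
  - rewrite Hit, Hjt; change (speed g t) with (sqrt (gram1 g t)).
    assert (Q1 := sqrt_def _ (Rlt_le _ _ HA)); assert (Q2 := sqrt_def _ (Rlt_le _ _ HB)).
    set (a := sqrt (gram1 g t)) in *; set (b := sqrt (gram2 g t)) in *.
    rewrite <- Q1, <- Q2; field; lra.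
Qed.

End Frenet.

Lemma geodesic_curvature_eq (c : R -> R3) (s : R) :
  smooth_curve c -> 0 < gram1 c s ->
  geodesic_curvature c s
  = det3 (c s) (D c s) (D (D c) s) / (gram1 c s * sqrt (gram1 c s)).
Proof.
  intros Hc HA.
  destruct (normalizer (D c) s (smooth_curve_D _ Hc) HA) as (i & Hi & Hloc).
  assert (Hloc' : locally s (fun u => tangent c u = scal (i u) (D c u))).
  { apply filter_imp with (2 := Hloc); intros u Hu; unfold tangent, speed; now rewrite Hu. }
  unfold geodesic_curvature.
  rewrite (D_ext_loc _ _ _ Hloc'), (locally_singleton _ _ Hloc').
  rewrite D_scal;
    [|now apply smooth_ex_derive|apply smooth_curve_diff, smooth_curve_D, Hc].
  transitivity (i s * i s * det3 (c s) (D c s) (D (D c) s) / speed c s).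
  - f_equal; unfold det3; r3_simpl; ring.
  - rewrite <- (locally_singleton _ _ Hloc).
    change (norm3 (D c s)) with (sqrt (gram1 c s)); change (speed c s) with (sqrt (gram1 c s)).
    assert (Hs := sqrt_lt_R0 _ HA); assert (Q1 := sqrt_def _ (Rlt_le _ _ HA)).
    set (a := sqrt (gram1 c s)) in *; rewrite <- Q1; field; lra.
Qed.

(** At [gram1], [gram2] and [triple] this is [kappa^2 (1 + lambda^2)^2]: there [kappa^2 = B / A^3]
    and [lambda^2 = d^2 A^3 / B^3]. Only even powers of curvature and modified torsion enter, hence
    no roots. *)
Definition bending (A B d : R) : R := B / A ^ 3 * (1 + d ^ 2 * A ^ 3 / B ^ 3) ^ 2.

Lemma Sadowsky_integrand_eq (g : R -> R3) (mu t : R) :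
  smooth_curve g -> 0 < gram1 g t -> 0 < gram2 g t ->
  (curvature g t ^ 2 * (1 + modified_torsion g t ^ 2) ^ 2 - mu) * speed g t
  = (bending (gram1 g t) (gram2 g t) (triple g t) - mu) * sqrt (gram1 g t).
Proof.
  intros Hg HA HB.
  rewrite curvature_eq, modified_torsion_eq by easy.
  change (speed g t) with (sqrt (gram1 g t)); f_equal; f_equal; unfold bending.
  assert (Hs1 := sqrt_lt_R0 _ HA); assert (Hs2 := sqrt_lt_R0 _ HB).
  assert (Q1 := sqrt_def _ (Rlt_le _ _ HA)); assert (Q2 := sqrt_def _ (Rlt_le _ _ HB)).
  set (a := sqrt (gram1 g t)) in *; set (b := sqrt (gram2 g t)) in *.
  rewrite <- Q1, <- Q2; field; lra.
Qed.

Lemma frenet_gram (L : R) (g : R -> R3) (t : R) :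
  frenet_curve L g -> 0 <= t <= L -> 0 < gram1 g t /\ 0 < gram2 g t.
Proof.
  intros [Hg H] Ht; destruct (H t Ht) as [Hs Hk].
  assert (HA : 0 < gram1 g t) by now apply norm3_pos_iff.
  split; [easy|].
  rewrite curvature_eq in Hk by easy.
  destruct (Rle_lt_or_eq_dec 0 (gram2 g t)) as [HB|HB]; [apply dot_nonneg|easy|].
  rewrite <- HB, sqrt_0 in Hk; unfold Rdiv in Hk; lra.
Qed.

(** The derivatives of [w] and the second derivative of [s] only produce terms along [c] and [c'],
    which the cross product and the determinant annihilate. What is left of the cross product is
    [c x c'], whose squared norm is that of [c'] because [c] is a unit vector orthogonal to [c']. *)
Lemma gram_of_spherical (g c : R -> R3) (w s : R -> R) (t : R) :
  smooth_curve c -> smooth w -> smooth s ->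
  locally t (fun u => D g u = scal (w u) (c (s u))) ->
  dot (c (s t)) (c (s t)) = 1 -> dot (c (s t)) (D c (s t)) = 0 ->
  gram1 g t = w t ^ 2 /\
  gram2 g t = w t ^ 4 * Derive s t ^ 2 * gram1 c (s t) /\
  triple g t = w t ^ 3 * Derive s t ^ 3
               * det3 (c (s t)) (D c (s t)) (D (D c) (s t)).
Proof.
  intros Hc Hw Hs Hloc H1 H0.
  assert (Hw' := smooth_Derive w Hw); assert (Hs' := smooth_Derive s Hs).
  assert (Hc1 := smooth_curve_D c Hc).
  assert (Hcs := smooth_curve_comp c s Hc Hs).
  assert (Hcs1 := smooth_curve_comp _ s Hc1 Hs).
  assert (E2 : forall u, D (fun u => scal (w u) (c (s u))) u
    = plus (scal (Derive w u) (c (s u)))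
           (scal (w u) (scal (Derive s u) (D c (s u))))).
  { intros u; rewrite D_scal by (try apply smooth_ex_derive; try apply smooth_curve_diff; easy).
    now rewrite D_comp by (try apply smooth_ex_derive; try apply smooth_curve_diff; easy). }
  assert (E3 : D (D (fun u => scal (w u) (c (s u)))) t
    = plus (plus (scal (Derive (Derive w) t) (c (s t)))
                 (scal (Derive w t) (scal (Derive s t) (D c (s t)))))
           (plus (scal (Derive w t) (scal (Derive s t) (D c (s t))))
                 (scal (w t) (plus (scal (Derive (Derive s) t) (D c (s t)))
                    (scal (Derive s t) (scal (Derive s t) (D (D c) (s t)))))))).
  { assert (Hv := smooth_curve_scal _ _ Hs' Hcs1).
    rewrite (D_ext_loc _ (fun u => plus (scal (Derive w u) (c (s u)))
      (scal (w u) (scal (Derive s u) (D c (s u))))) t (filter_forall _ E2)).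
    rewrite D_plus; [|now apply smooth_curve_diff, smooth_curve_scal
                     |now apply smooth_curve_diff, smooth_curve_scal].
    rewrite (D_scal w (fun u => scal (Derive s u) (D c (s u))));
      [|now apply smooth_ex_derive|now apply smooth_curve_diff].
    rewrite (D_scal (Derive w) (fun u => c (s u)));
      [|now apply smooth_ex_derive|now apply smooth_curve_diff].
    rewrite (D_scal (Derive s) (fun u => D c (s u)));
      [|now apply smooth_ex_derive|now apply smooth_curve_diff].
    rewrite (D_comp (D c) s), (D_comp c s);
      [reflexivity| | | |]; try (now apply smooth_ex_derive); now apply smooth_curve_diff. }
  assert (Hloc2 := locally_D_ext _ _ _ Hloc).
  unfold gram1 at 1, gram2, triple.
  rewrite (D_ext_loc _ (D (fun u => scal (w u) (c (s u)))) _ Hloc2).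
  rewrite (D_ext_loc _ (fun u => scal (w u) (c (s u))) _ Hloc).
  rewrite (locally_singleton _ _ Hloc), E2, E3.
  split; [|split].
  - transitivity (w t ^ 2 * dot (c (s t)) (c (s t))); [r3_simpl; ring|rewrite H1; ring].
  - transitivity (w t ^ 4 * Derive s t ^ 2
      * dot (cross (c (s t)) (D c (s t))) (cross (c (s t)) (D c (s t)))).
    + r3_simpl; ring.
    + rewrite lagrange_identity, H1, H0; unfold gram1; ring.
  - unfold det3; r3_simpl; ring.
Qed.

(** * Smooth families of curves, and bounds that persist near the parameter value 0 *)

Lemma smooth_pow (f : R -> R) (n : nat) : smooth f -> smooth (fun x => f x ^ n).
Proof.
  intros H; induction n as [|n IH]; [exact (smooth_const 1)|].
  exact (smooth_mult f (fun x => f x ^ n) H IH).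
Qed.

Lemma smooth2_pow (f : R -> R -> R) (n : nat) :
  smooth2 f -> smooth2 (fun e t => f e t ^ n).
Proof.
  intros H; apply (smooth2_comp1 (fun x => x ^ n)); [|easy].
  apply (smooth_pow (fun x => x)), smooth_id.
Qed.

Lemma smooth_family_slice (C : R -> R -> R3) (e : R) : smooth_family C -> smooth_curve (C e).
Proof.
  intros (H1 & H2 & H3); split; [|split].
  - exact (smooth2_slice _ e H1).
  - exact (smooth2_slice _ e H2).
  - exact (smooth2_slice _ e H3).
Qed.

Lemma smooth_family_diff1 (C : R -> R -> R3) (e t : R) :
  smooth_family C -> diff_curve (fun z => C z t) e.
Proof.
  intros (H1 & H2 & H3); split; [|split].
  - exact (smooth2_ex_d1 _ e t H1).
  - exact (smooth2_ex_d1 _ e t H2).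
  - exact (smooth2_ex_d1 _ e t H3).
Qed.

Lemma smooth_family_D (C : R -> R -> R3) :
  smooth_family C -> smooth_family (fun e => D (C e)).
Proof.
  intros (H1 & H2 & H3); split; [|split].
  - exact (smooth2_d2 _ H1).
  - exact (smooth2_d2 _ H2).
  - exact (smooth2_d2 _ H3).
Qed.

Lemma smooth_family_const (c : R -> R3) : smooth_curve c -> smooth_family (fun _ => c).
Proof.
  intros (H1 & H2 & H3); split; [|split].
  - exact (smooth2_snd _ H1).
  - exact (smooth2_snd _ H2).
  - exact (smooth2_snd _ H3).
Qed.

Lemma smooth_family_fst (c : R -> R3) : smooth_curve c -> smooth_family (fun e _ => c e).
Proof.
  intros (H1 & H2 & H3); split; [|split].
  - exact (smooth2_fst _ H1).
  - exact (smooth2_fst _ H2).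
  - exact (smooth2_fst _ H3).
Qed.

Lemma smooth_family_plus (C C' : R -> R -> R3) :
  smooth_family C -> smooth_family C' -> smooth_family (fun e t => plus (C e t) (C' e t)).
Proof.
  intros (H1 & H2 & H3) (H1' & H2' & H3'); split; [|split].
  - exact (smooth2_plus _ _ H1 H1').
  - exact (smooth2_plus _ _ H2 H2').
  - exact (smooth2_plus _ _ H3 H3').
Qed.

Lemma smooth_family_scal (a : R -> R -> R) (C : R -> R -> R3) :
  smooth2 a -> smooth_family C -> smooth_family (fun e t => scal (a e t) (C e t)).
Proof.
  intros Ha (H1 & H2 & H3); split; [|split].
  - exact (smooth2_mult _ _ Ha H1).
  - exact (smooth2_mult _ _ Ha H2).
  - exact (smooth2_mult _ _ Ha H3).
Qed.

Lemma smooth_family_reparam (C : R -> R -> R3) (h : R -> R) :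
  smooth_family C -> smooth h -> smooth_family (fun e t => C e (h t)).
Proof.
  intros (H1 & H2 & H3) Hh; split; [|split].
  - exact (smooth2_reparam _ _ H1 Hh).
  - exact (smooth2_reparam _ _ H2 Hh).
  - exact (smooth2_reparam _ _ H3 Hh).
Qed.

Lemma smooth_curve_slice1 (C : R -> R -> R3) (t : R) :
  smooth_family C -> smooth_curve (fun e => C e t).
Proof.
  assert (Hf : forall f, smooth2 f -> smooth (fun e => f e t)).
  { intros f Hf; apply smooth_Ck; intros n; revert f Hf; induction n as [|n IH];
      intros f Hf; [easy|].
    split; [intros e; now apply (smooth2_ex_d1 f)|].
    exact (IH (d1 f) (smooth2_d1 f Hf)). }
  intros (H1 & H2 & H3); split; [|split].
  - exact (Hf _ H1).
  - exact (Hf _ H2).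
  - exact (Hf _ H3).
Qed.

Lemma smooth_family_cross (C C' : R -> R -> R3) :
  smooth_family C -> smooth_family C' -> smooth_family (fun e t => cross (C e t) (C' e t)).
Proof.
  intros (H1 & H2 & H3) (H1' & H2' & H3'); split; [|split];
  apply smooth2_minus; now apply smooth2_mult.
Qed.

Lemma smooth2_dot (C C' : R -> R -> R3) :
  smooth_family C -> smooth_family C' -> smooth2 (fun e t => dot (C e t) (C' e t)).
Proof.
  intros (H1 & H2 & H3) (H1' & H2' & H3').
  apply smooth2_plus; [apply smooth2_plus|]; now apply smooth2_mult.
Qed.

Lemma smooth2_gram1 (C : R -> R -> R3) : smooth_family C -> smooth2 (fun e => gram1 (C e)).
Proof. intros H; apply smooth2_dot; now apply smooth_family_D. Qed.

Lemma smooth2_gram2 (C : R -> R -> R3) : smooth_family C -> smooth2 (fun e => gram2 (C e)).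
Proof.
  intros H; assert (H1 := smooth_family_D _ H); assert (H2 := smooth_family_D _ H1).
  apply smooth2_dot; now apply smooth_family_cross.
Qed.

Lemma smooth2_triple (C : R -> R -> R3) : smooth_family C -> smooth2 (fun e => triple (C e)).
Proof.
  intros H; assert (H1 := smooth_family_D _ H); assert (H2 := smooth_family_D _ H1).
  apply smooth2_dot; [now apply smooth_family_D|now apply smooth_family_cross].
Qed.

(** Equality of two curves on [0, L] passes to their derivatives by locality only at interior
    points. This closure argument carries the resulting identities to the two end points. *)
Lemma continuous_zero_closure (k : R -> R) (a b t : R) :
  a < b -> a <= t <= b -> continuous k t -> (forall u, a < u < b -> k u = 0) -> k t = 0.
Proof.
  intros Hab Ht Hk H0; destruct (Req_dec (k t) 0) as [E|E]; [easy|exfalso].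
  destruct (proj1 (filterlim_locally (F := locally t) _ _) Hk
              (mkposreal _ (Rabs_pos_lt _ E))) as [d Hd].
  assert (Hne : forall u, Rabs (u - t) < d -> a < u < b -> False).
  { intros u Hu Hu'; specialize (Hd u Hu).
    change (Rabs (k u - k t) < Rabs (k t)) in Hd.
    rewrite (H0 u Hu'), Rminus_0_l, Rabs_Ropp in Hd; lra. }
  assert (Hd0 := cond_pos d).
  destruct (Rlt_dec t b) as [Htb|Htb].
  - pose proof (Rmin_l d (b - t)); pose proof (Rmin_r d (b - t)).
    assert (0 < Rmin d (b - t)) by (apply Rmin_pos; lra).
    apply (Hne (t + Rmin d (b - t) / 2)); [rewrite Rabs_pos_eq; lra|lra].
  - pose proof (Rmin_l d (b - a)); pose proof (Rmin_r d (b - a)).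
    assert (0 < Rmin d (b - a)) by (apply Rmin_pos; lra).
    apply (Hne (t - Rmin d (b - a) / 2)); [rewrite Rabs_left; lra|lra].
Qed.

Lemma smooth_eq_closure (f h : R -> R) (a b t : R) :
  smooth f -> smooth h -> a < b -> a <= t <= b ->
  (forall u, a < u < b -> f u = h u) -> f t = h t.
Proof.
  intros Hf Hh Hab Ht H.
  assert (E : f t - h t = 0); [|lra].
  apply (continuous_zero_closure (fun t => f t - h t) a b t Hab Ht).
  - now apply smooth_continuous, smooth_minus.
  - intros u Hu; rewrite H by easy; ring.
Qed.

(** The factor 3 provides a margin: members of a family near the given one lose at most [m], and
    [clamp m] is the identity from [2 * m] on. *)
Lemma positive_min (f : R -> R) (a b : R) :
  a <= b -> smooth f -> (forall t, a <= t <= b -> 0 < f t) ->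
  exists m, 0 < m /\ forall t, a <= t <= b -> 3 * m <= f t.
Proof.
  intros Hab Hf H.
  destruct (continuity_ab_min f a b Hab) as (x & Hx & Hx').
  { intros t _; apply continuity_pt_filterlim, (smooth_continuous f t Hf). }
  exists (f x / 3); split; [specialize (H x Hx'); lra|].
  intros t Ht; specialize (Hx t Ht); lra.
Qed.

Lemma uniform_lower_bound (f : R -> R -> R) (a b m : R) :
  smooth2 f -> 0 < m -> (forall t, a <= t <= b -> 3 * m <= f 0 t) ->
  locally 0 (fun e => forall t, a <= t <= b -> 2 * m <= f e t).
Proof.
  intros Hf Hm H.
  destruct (uniform_continuity_2d_1d' f a b 0
    (fun t _ => smooth2_continuous f 0 t Hf) (mkposreal m Hm)) as [d Hd].
  exists d; intros e He t Ht.
  change (Rabs (e - 0) < d) in He; rewrite Rminus_0_r in He.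
  assert (Hd0 := cond_pos d); apply Rabs_def2 in He.
  assert (B : Rabs (f e t - f 0 t) < m).
  { apply (Hd t 0 t e); try lra.
    rewrite Rminus_diag, Rabs_R0; apply cond_pos. }
  apply Rabs_def2 in B; specialize (H t Ht); lra.
Qed.

(** * The first variation of the Sadowsky functional *)

(** The clamped form of [(bending A B d - mu) * sqrt A], smooth for all real values of the three
    arguments. *)
Definition sadowsky_density (m mu A B d : R) : R :=
  (B * cinv m A ^ 3 * (1 + d ^ 2 * (A ^ 3 * cinv m B ^ 3)) ^ 2 - mu) * csqrt m A.

Lemma sadowsky_density_eq (m mu A B d : R) :
  0 < m -> 2 * m <= A -> 2 * m <= B ->
  sadowsky_density m mu A B d = (bending A B d - mu) * sqrt A.
Proof.
  intros Hm HA HB; unfold sadowsky_density, bending.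
  rewrite !cinv_eq, csqrt_eq by easy; f_equal; f_equal; field; lra.
Qed.

Lemma smooth2_sadowsky_density (m mu : R) (A B d : R -> R -> R) :
  0 < m -> smooth2 A -> smooth2 B -> smooth2 d ->
  smooth2 (fun e t => sadowsky_density m mu (A e t) (B e t) (d e t)).
Proof.
  intros Hm HA HB Hd; unfold sadowsky_density.
  assert (HiA := smooth2_comp1 _ _ (smooth_cinv m Hm) HA).
  assert (HiB := smooth2_comp1 _ _ (smooth_cinv m Hm) HB).
  apply smooth2_mult; [|exact (smooth2_comp1 _ _ (smooth_csqrt m Hm) HA)].
  apply smooth2_minus; [|apply smooth2_const].
  apply smooth2_mult.
  - apply smooth2_mult; [easy|]; now apply smooth2_pow.
  - apply (smooth2_pow (fun e t => 1 + d e t ^ 2 * (A e t ^ 3 * cinv m (B e t) ^ 3))).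
    apply smooth2_plus; [apply smooth2_const|].
    apply smooth2_mult; [now apply smooth2_pow|].
    apply smooth2_mult; now apply smooth2_pow.
Qed.

Lemma Derive_sadowsky_density (m mu : R) : 0 < m ->
  exists cA cB cd : R -> R -> R -> R, forall (A B d : R -> R) (e : R),
    ex_derive A e -> ex_derive B e -> ex_derive d e ->
    Derive (fun z => sadowsky_density m mu (A z) (B z) (d z)) e
    = cA (A e) (B e) (d e) * Derive A e + cB (A e) (B e) (d e) * Derive B e
      + cd (A e) (B e) (d e) * Derive d e.
Proof.
  intros Hm.
  set (i := cinv m); set (r := csqrt m).
  assert (Hi : forall x, ex_derive i x) by (intros x; apply smooth_ex_derive, smooth_cinv, Hm).
  assert (Hr : forall x, ex_derive r x) by (intros x; apply smooth_ex_derive, smooth_csqrt, Hm).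
  exists (fun A B d =>
    B * (3 * i A ^ 2 * Derive i A) * (1 + d ^ 2 * (A ^ 3 * i B ^ 3)) ^ 2 * r A
    + B * i A ^ 3 * (2 * (1 + d ^ 2 * (A ^ 3 * i B ^ 3)) * (d ^ 2 * (3 * A ^ 2 * i B ^ 3))) * r A
    + (B * i A ^ 3 * (1 + d ^ 2 * (A ^ 3 * i B ^ 3)) ^ 2 - mu) * Derive r A).
  exists (fun A B d =>
    i A ^ 3 * (1 + d ^ 2 * (A ^ 3 * i B ^ 3)) ^ 2 * r A
    + B * i A ^ 3 * (2 * (1 + d ^ 2 * (A ^ 3 * i B ^ 3))
        * (d ^ 2 * (A ^ 3 * (3 * i B ^ 2 * Derive i B)))) * r A).
  exists (fun A B d =>
    B * i A ^ 3 * (2 * (1 + d ^ 2 * (A ^ 3 * i B ^ 3)) * (2 * d * (A ^ 3 * i B ^ 3))) * r A).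
  intros A B d e HA HB Hd; apply is_derive_unique; unfold sadowsky_density; fold i r.
  auto_derive.
  - repeat split; auto.
  - change (Derive (fun x => A x) e) with (Derive A e).
    change (Derive (fun x => B x) e) with (Derive B e).
    change (Derive (fun x => d x) e) with (Derive d e).
    change (Derive (fun x => i x) (A e)) with (Derive i (A e)).
    change (Derive (fun x => i x) (B e)) with (Derive i (B e)).
    change (Derive (fun x => r x) (A e)) with (Derive r (A e)).
    simpl; ring.
Qed.

Lemma Sadowsky_eq_RInt_density (mu L m : R) (g : R -> R3) :
  0 < L -> 0 < m -> smooth_curve g ->
  (forall t, 0 <= t <= L -> 2 * m <= gram1 g t) ->
  (forall t, 0 <= t <= L -> 2 * m <= gram2 g t) ->
  Sadowsky mu L g
  = RInt (fun t => sadowsky_density m mu (gram1 g t) (gram2 g t) (triple g t)) 0 L.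
Proof.
  intros HL Hm Hg HA HB; apply RInt_ext; intros t.
  rewrite Rmin_left, Rmax_right by lra; intros Ht.
  assert (HA' := HA t ltac:(lra)); assert (HB' := HB t ltac:(lra)).
  rewrite Sadowsky_integrand_eq by (try easy; lra).
  now rewrite sadowsky_density_eq.
Qed.

Section FirstVariation.

Variables (mu L m : R) (g : R -> R3).
Hypothesis HL : 0 < L.
Hypothesis Hm : 0 < m.
Hypothesis Hg : smooth_curve g.
Hypothesis HA : forall t, 0 <= t <= L -> 3 * m <= gram1 g t.
Hypothesis HB : forall t, 0 <= t <= L -> 3 * m <= gram2 g t.

Definition family_density (G : R -> R -> R3) (e t : R) : R :=
  sadowsky_density m mu (gram1 (G e) t) (gram2 (G e) t) (triple (G e) t).

Lemma smooth2_family_density (G : R -> R -> R3) :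
  smooth_family G -> smooth2 (family_density G).
Proof.
  intros HG; apply (smooth2_sadowsky_density m mu); [easy| | |].
  - now apply smooth2_gram1.
  - now apply smooth2_gram2.
  - now apply smooth2_triple.
Qed.

Lemma base_jets (G : R -> R -> R3) (t : R) :
  (forall t, 0 <= t <= L -> G 0 t = g t) -> 0 < t < L ->
  D (G 0) t = D g t /\ D (D (G 0)) t = D (D g) t /\ D (D (D (G 0))) t = D (D (D g)) t.
Proof.
  intros H0 Ht.
  assert (Hl : locally t (fun u => G 0 u = g u)).
  { apply filter_imp with (2 := locally_Ioo 0 L t Ht); intros u Hu; apply H0; lra. }
  assert (Hl1 := locally_D_ext _ _ _ Hl); assert (Hl2 := locally_D_ext _ _ _ Hl1).
  split; [|split].
  - exact (locally_singleton _ _ Hl1).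
  - exact (locally_singleton _ _ Hl2).
  - exact (D_ext_loc _ _ _ Hl2).
Qed.

Lemma family_grams_bound (G : R -> R -> R3) :
  smooth_family G -> (forall t, 0 <= t <= L -> G 0 t = g t) ->
  locally 0 (fun e => forall t, 0 <= t <= L ->
    2 * m <= gram1 (G e) t /\ 2 * m <= gram2 (G e) t).
Proof.
  intros HG H0.
  assert (H1 : locally 0 (fun e => forall t, 0 <= t <= L -> 2 * m <= gram1 (G e) t)).
  { apply (uniform_lower_bound (fun e => gram1 (G e))); [now apply smooth2_gram1|easy|].
    intros t Ht; replace (gram1 (G 0) t) with (gram1 g t); [now apply HA|].
    apply (smooth_eq_closure _ _ 0 L); try easy.
    - now apply smooth_gram1.
    - now apply smooth_gram1, smooth_family_slice.
    - intros u Hu; unfold gram1; now rewrite (proj1 (base_jets G u H0 Hu)). }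
  assert (H2 : locally 0 (fun e => forall t, 0 <= t <= L -> 2 * m <= gram2 (G e) t)).
  { apply (uniform_lower_bound (fun e => gram2 (G e))); [now apply smooth2_gram2|easy|].
    intros t Ht; replace (gram2 (G 0) t) with (gram2 g t); [now apply HB|].
    apply (smooth_eq_closure _ _ 0 L); try easy.
    - now apply smooth_gram2.
    - now apply smooth_gram2, smooth_family_slice.
    - intros u Hu; unfold gram2; destruct (base_jets G u H0 Hu) as (E1 & E2 & _).
      now rewrite E1, E2. }
  generalize H1 H2; apply locally_imp2; intros e He1 He2 t Ht; split; auto.
Qed.

Lemma locally_Sadowsky_eq (G : R -> R -> R3) :
  smooth_family G -> (forall t, 0 <= t <= L -> G 0 t = g t) ->
  locally 0 (fun e => Sadowsky mu L (G e) = RInt (family_density G e) 0 L).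
Proof.
  intros HG H0; apply filter_imp with (2 := family_grams_bound G HG H0).
  intros e He; apply Sadowsky_eq_RInt_density; try easy.
  - now apply smooth_family_slice.
  - intros t Ht; now apply He.
  - intros t Ht; now apply He.
Qed.

Lemma is_derive_Sadowsky (G : R -> R -> R3) :
  smooth_family G -> (forall t, 0 <= t <= L -> G 0 t = g t) ->
  is_derive (fun e => Sadowsky mu L (G e)) 0 (RInt (d1 (family_density G) 0) 0 L).
Proof.
  intros HG H0; apply (is_derive_ext_loc (fun e => RInt (family_density G e) 0 L)).
  - apply filter_imp with (2 := locally_Sadowsky_eq G HG H0); intros e He; now symmetry.
  - now apply is_derive_RInt_smooth2, smooth2_family_density.
Qed.

(* [V1], [V2], [V3] are the velocities, along a family, of the derivatives [p],
   [q], [r] of its first member; [cA], [cB], [cd] the partial derivatives of the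
   density. *)
Definition first_variation (cA cB cd : R) (p q r V1 V2 V3 : R3) : R :=
  cA * (2 * dot p V1) + cB * (2 * dot (cross p q) (plus (cross V1 q) (cross p V2)))
  + cd * (det3 V1 q r + det3 p V2 r + det3 p q V3).

(** The coefficients are chosen before the family [G]. The derivative at 0 is thus one and the same
    linear form, in the velocities of the first three derivatives, for all families through [g];
    this linearity yields the multiplier. *)
Lemma d1_family_density : exists cA cB cd : R -> R,
  forall G, smooth_family G -> (forall t, 0 <= t <= L -> G 0 t = g t) ->
  forall t, 0 < t < L ->
  d1 (family_density G) 0 t
  = first_variation (cA t) (cB t) (cd t) (D g t) (D (D g) t) (D (D (D g)) t)
      (D (fun e => D (G e) t) 0) (D (fun e => D (D (G e)) t) 0)
      (D (fun e => D (D (D (G e))) t) 0).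
Proof.
  destruct (Derive_sadowsky_density m mu Hm) as (cA & cB & cd & Hc).
  exists (fun t => cA (gram1 g t) (gram2 g t) (triple g t)).
  exists (fun t => cB (gram1 g t) (gram2 g t) (triple g t)).
  exists (fun t => cd (gram1 g t) (gram2 g t) (triple g t)).
  intros G HG H0 t Ht.
  assert (S1 := smooth_family_D _ HG); assert (S2 := smooth_family_D _ S1);
    assert (S3 := smooth_family_D _ S2).
  assert (F1 := smooth_family_diff1 _ 0 t S1); assert (F2 := smooth_family_diff1 _ 0 t S2);
    assert (F3 := smooth_family_diff1 _ 0 t S3).
  assert (F12 := smooth_family_diff1 _ 0 t (smooth_family_cross _ _ S1 S2)).
  destruct (base_jets G t H0 Ht) as (E1 & E2 & E3).
  unfold d1, family_density.
  rewrite (Hc (fun e => gram1 (G e) t) (fun e => gram2 (G e) t) (fun e => triple (G e) t));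
    [|exact (smooth2_ex_d1 _ 0 t (smooth2_gram1 G HG))
     |exact (smooth2_ex_d1 _ 0 t (smooth2_gram2 G HG))
     |exact (smooth2_ex_d1 _ 0 t (smooth2_triple G HG))].
  unfold gram1, gram2, triple, det3.
  rewrite (Derive_dot (fun e => D (G e) t) (fun e => D (G e) t) 0 F1 F1).
  rewrite (Derive_dot (fun e => cross (D (G e) t) (D (D (G e)) t))
                      (fun e => cross (D (G e) t) (D (D (G e)) t)) 0 F12 F12).
  rewrite (Derive_dot (fun e => D (D (D (G e))) t)
                      (fun e => cross (D (G e) t) (D (D (G e)) t)) 0 F3 F12).
  rewrite (D_cross (fun e => D (G e) t) (fun e => D (D (G e)) t) 0 F1 F2).
  rewrite E1, E2, E3; unfold first_variation, det3.
  set (V1 := D (fun e => D (G e) t) 0).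
  set (V2 := D (fun e => D (D (G e)) t) 0).
  set (V3 := D (fun e => D (D (D (G e))) t) 0).
  f_equal; [f_equal|]; f_equal; r3_simpl; ring.
Qed.

End FirstVariation.

(** * Existence of the end point multiplier *)

Definition shifted (C : R -> R -> R3) (r b : R -> R3) (k : R -> R) (e t : R) : R3 :=
  plus (plus (C e t) (r e)) (scal (k t) (b e)).

Lemma smooth_family_shifted (C : R -> R -> R3) (r b : R -> R3) (k : R -> R) :
  smooth_family C -> smooth_curve r -> smooth_curve b -> smooth k ->
  smooth_family (shifted C r b k).
Proof.
  intros HC Hr Hb Hk; apply smooth_family_plus; [apply smooth_family_plus|].
  - easy.
  - now apply smooth_family_fst.
  - apply (smooth_family_scal (fun _ t => k t)); [now apply smooth2_snd|].
    now apply smooth_family_fst.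
Qed.

Lemma D_constant (u : R3) (t : R) : D (fun _ => u) t = (0, 0, 0).
Proof. unfold D; now rewrite !Derive_const. Qed.

(** Differentiation in [t] kills the translation and turns [k] into its derivative, so the shape is
    preserved and the lemma can be iterated up to the third derivative. *)
Lemma D_shifted (C : R -> R -> R3) (r b : R -> R3) (k : R -> R) (e : R) :
  smooth_family C -> smooth k ->
  D (shifted C r b k e) = shifted (fun e => D (C e)) (fun _ => (0, 0, 0)) b (Derive k) e.
Proof.
  intros HC Hk; extensionality t; unfold shifted.
  assert (HCe := smooth_family_slice C e HC).
  assert (H1 := smooth_curve_scal k (fun _ => b e) Hk (smooth_curve_const (b e))).
  assert (H2 := smooth_curve_plus _ _ HCe (smooth_curve_const (r e))).
  rewrite (D_plus (fun t => plus (C e t) (r e)) (fun t => scal (k t) (b e)));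
    [|now apply smooth_curve_diff|now apply smooth_curve_diff].
  rewrite (D_plus (C e) (fun _ => r e));
    [|now apply smooth_curve_diff|apply smooth_curve_diff, smooth_curve_const].
  rewrite (D_scal k (fun _ => b e));
    [|now apply smooth_ex_derive|apply smooth_curve_diff, smooth_curve_const].
  rewrite !D_constant; apply R3_ext; r3_simpl; unfold X1, X2, X3; simpl; ring.
Qed.

Lemma D_shifted_velocity (C : R -> R -> R3) (u : R3) (b : R -> R3) (k : R -> R) (t : R) :
  smooth_family C -> smooth_curve b ->
  D (fun e => shifted C (fun _ => u) b k e t) 0
  = plus (D (fun e => C e t) 0) (scal (k t) (D b 0)).
Proof.
  intros HC Hb; unfold shifted.
  assert (H1 := smooth_curve_slice1 C t HC).
  assert (H2 := smooth_curve_plus _ _ H1 (smooth_curve_const u)).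
  assert (H3 := smooth_curve_scal (fun _ => k t) b (smooth_const _) Hb).
  rewrite (D_plus (fun e => plus (C e t) u) (fun e => scal (k t) (b e)));
    [|now apply smooth_curve_diff|now apply smooth_curve_diff].
  rewrite (D_plus (fun e => C e t) (fun _ => u));
    [|now apply smooth_curve_diff|apply smooth_curve_diff, smooth_curve_const].
  rewrite (D_scal (fun _ => k t) b);
    [|apply ex_derive_const|now apply smooth_curve_diff].
  rewrite D_constant, Derive_const; apply R3_ext; r3_simpl; unfold X1, X2, X3; simpl; ring.
Qed.

Lemma shifted_velocities (C : R -> R -> R3) (r b : R -> R3) (k : R -> R) (t : R) :
  smooth_family C -> smooth_curve b -> smooth k ->
  D (fun e => D (shifted C r b k e) t) 0
    = plus (D (fun e => D (C e) t) 0) (scal (Derive k t) (D b 0)) /\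
  D (fun e => D (D (shifted C r b k e)) t) 0
    = plus (D (fun e => D (D (C e)) t) 0) (scal (Derive (Derive k) t) (D b 0)) /\
  D (fun e => D (D (D (shifted C r b k e))) t) 0
    = plus (D (fun e => D (D (D (C e))) t) 0) (scal (Derive (Derive (Derive k)) t) (D b 0)).
Proof.
  intros HC Hb Hk.
  assert (HC1 := smooth_family_D C HC); assert (HC2 := smooth_family_D _ HC1);
    assert (HC3 := smooth_family_D _ HC2).
  assert (Hk1 := smooth_Derive k Hk); assert (Hk2 := smooth_Derive _ Hk1).
  set (z := (0, 0, 0) : R3).
  assert (E1 : forall e, D (shifted C r b k e)
    = shifted (fun e => D (C e)) (fun _ => z) b (Derive k) e)
    by (intros e; now apply D_shifted).
  assert (E2 : forall e, D (D (shifted C r b k e))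
    = shifted (fun e => D (D (C e))) (fun _ => z) b (Derive (Derive k)) e)
    by (intros e; rewrite E1; now apply (D_shifted (fun e => D (C e)))).
  assert (E3 : forall e, D (D (D (shifted C r b k e)))
    = shifted (fun e => D (D (D (C e)))) (fun _ => z) b (Derive (Derive (Derive k))) e)
    by (intros e; rewrite E2; now apply (D_shifted (fun e => D (D (C e))))).
  split; [|split].
  - replace (fun e => D (shifted C r b k e) t)
      with (fun e => shifted (fun e => D (C e)) (fun _ => z) b (Derive k) e t)
      by (extensionality e; now rewrite E1).
    now apply (D_shifted_velocity (fun e => D (C e))).
  - replace (fun e => D (D (shifted C r b k e)) t)
      with (fun e => shifted (fun e => D (D (C e))) (fun _ => z) b (Derive (Derive k)) e t)
      by (extensionality e; now rewrite E2).
    now apply (D_shifted_velocity (fun e => D (D (C e)))).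
  - replace (fun e => D (D (D (shifted C r b k e))) t)
      with (fun e => shifted (fun e => D (D (D (C e)))) (fun _ => z) b
                       (Derive (Derive (Derive k))) e t)
      by (extensionality e; now rewrite E3).
    now apply (D_shifted_velocity (fun e => D (D (D (C e))))).
Qed.

Lemma RInt_add (f h : R -> R) (a b : R) :
  smooth f -> smooth h -> RInt (fun t => f t + h t) a b = RInt f a b + RInt h a b.
Proof. intros Hf Hh; apply (RInt_plus f h); now apply smooth_ex_RInt. Qed.

Lemma RInt_mul (f : R -> R) (a b c : R) :
  smooth f -> RInt (fun t => c * f t) a b = c * RInt f a b.
Proof. intros Hf; apply (RInt_scal f); now apply smooth_ex_RInt. Qed.

Lemma RInt_split (f : R -> R) (a b c : R) :
  smooth f -> RInt f a c = RInt f a b + RInt f b c.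
Proof.
  intros Hf; symmetry; apply (RInt_Chasles f); now apply smooth_ex_RInt.
Qed.

Lemma smooth_curve_minus (c c' : R -> R3) :
  smooth_curve c -> smooth_curve c' -> smooth_curve (fun t => minus (c t) (c' t)).
Proof.
  intros (H1 & H2 & H3) (H1' & H2' & H3'); split; [|split].
  - exact (smooth_minus _ _ H1 H1').
  - exact (smooth_minus _ _ H2 H2').
  - exact (smooth_minus _ _ H3 H3').
Qed.

Lemma D_minus_l (u : R3) (c : R -> R3) (t : R) :
  smooth_curve c -> D (fun e => minus u (c e)) t = scal (-1) (D c t).
Proof.
  intros (H1 & H2 & H3).
  assert (H : forall (x : R) f, smooth f -> Derive (fun e => x - f e) t = -1 * Derive f t).
  { intros x f Hf; rewrite Derive_minus;
      [|apply ex_derive_const|now apply smooth_ex_derive].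
    rewrite Derive_const; ring. }
  apply R3_ext; [exact (H _ _ H1)|exact (H _ _ H2)|exact (H _ _ H3)].
Qed.

Lemma D_scal_id (u : R3) : D (fun e => scal e u) 0 = u.
Proof.
  rewrite (D_scal (fun e => e) (fun _ => u));
    [|apply ex_derive_id|apply smooth_curve_diff, smooth_curve_const].
  rewrite Derive_id, D_constant; apply R3_ext; r3_simpl; unfold X1, X2, X3; simpl; ring.
Qed.

Lemma smooth_curve_scal_id (u : R3) : smooth_curve (fun e => scal e u).
Proof.
  apply (smooth_curve_scal (fun e => e) (fun _ => u)); [apply smooth_id|].
  apply smooth_curve_const.
Qed.

Definition e1 : R3 := (1, 0, 0).
Definition e2 : R3 := (0, 1, 0).
Definition e3 : R3 := (0, 0, 1).

(* Subtracting from an arbitrary variation a translation and a cutoff multiple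
   of the displacement of the end points gives a variation with fixed ends; as
   the first variation is linear, [- b0] collects its values on the three
   coordinate displacements. *)
Lemma multiplier_exists (mu L m : R) (g : R -> R3) :
  0 < L -> 0 < m -> smooth_curve g ->
  (forall t, 0 <= t <= L -> 3 * m <= gram1 g t) ->
  (forall t, 0 <= t <= L -> 3 * m <= gram2 g t) ->
  Sadowsky_critical mu L g -> exists b0, endpoint_multiplier mu L g b0.
Proof.
  intros HL Hm Hg HA HB Hcrit.
  (* The cutoff rises from 0 to 1 within the middle third of [0, L], hence is constant near both
     ends. *)
  set (k := fun t => step (3 * t / L - 1)).
  assert (Hk : smooth k).
  { apply (smooth_comp step (fun t => 3 * t / L - 1)); [apply smooth_step|].
    apply smooth_minus; [|apply smooth_const].
    apply (smooth_mult (fun t => 3 * t) (fun _ => / L)); [|apply smooth_const].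
    apply (smooth_mult (fun _ => 3) (fun t => t)); [apply smooth_const|apply smooth_id]. }
  assert (Hk0 : forall t, t <= L / 3 -> k t = 0).
  { intros t Ht; apply step_0.
    assert (3 * t / L <= 1); [|lra].
    apply Rmult_le_reg_r with L; [easy|].
    replace (3 * t / L * L) with (3 * t) by (field; lra); lra. }
  assert (Hk1 : forall t, L - L / 3 <= t -> k t = 1).
  { intros t Ht; apply step_1.
    assert (2 <= 3 * t / L); [|lra].
    apply Rmult_le_reg_r with L; [easy|].
    replace (3 * t / L * L) with (3 * t) by (field; lra); lra. }
  set (z := (0, 0, 0) : R3).
  (* The test family that leaves the start of [g] in place and moves its end by [e] times [u]. *)
  set (K := fun u => shifted (fun _ => g) (fun _ => z) (fun e => scal e u) k).
  assert (HK : forall u, smooth_family (K u)).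
  { intros u; exact (smooth_family_shifted _ _ _ _ (smooth_family_const g Hg)
      (smooth_curve_const z) (smooth_curve_scal_id u) Hk). }
  assert (HK0 : forall u t, 0 <= t <= L -> K u 0 t = g t).
  { intros u t _; unfold K, shifted, z; apply R3_ext; r3_simpl;
      unfold X1, X2, X3; simpl; ring. }
  set (dK := fun u => d1 (family_density mu m (K u)) 0).
  assert (HdK : forall u, smooth (dK u)).
  { intros u; apply (smooth2_slice (d1 (family_density mu m (K u)))).
    now apply smooth2_d1, smooth2_family_density. }
  set (I := fun u => RInt (dK u) 0 L).
  exists (- I e1, - I e2, - I e3).
  intros G HG; destruct HG as (HGs & HG0 & d & Hd & Hends).
  assert (HG_0 := smooth_curve_slice1 G 0 HGs); assert (HG_L := smooth_curve_slice1 G L HGs).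
  set (w := fun e => minus (G e L) (G e 0)).
  assert (Hw : smooth_curve w) by now apply smooth_curve_minus.
  (* The translation [r e] brings the initial point back to [g 0]. The far end is then [g 0] plus
     [w e], which misses [g L] by exactly [b e]; the cutoff multiple of [b e] repairs this without
     touching the start. *)
  set (r := fun e => minus (g 0) (G e 0)).
  set (b := fun e => minus (minus (g L) (g 0)) (w e)).
  assert (Hr : smooth_curve r)
    by (apply smooth_curve_minus; [exact (smooth_curve_const _)|easy]).
  assert (Hb : smooth_curve b)
    by (apply smooth_curve_minus; [exact (smooth_curve_const _)|easy]).
  set (G' := shifted G r b k).
  assert (HG's : smooth_family G')
    by exact (smooth_family_shifted _ _ _ _ HGs Hr Hb Hk).
  assert (HG'0 : forall t, 0 <= t <= L -> G' 0 t = g t).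
  { intros t Ht; unfold G', shifted, r, b, w.
    rewrite (HG0 t Ht), (HG0 0), (HG0 L) by lra.
    apply R3_ext; r3_simpl; ring. }
  assert (Hleft : forall e t, 0 <= t <= L -> t <= d -> t <= L / 3 -> G' e t = g t).
  { intros e t Ht Htd Ht3.
    assert (E := proj1 (Hends e t Ht) Htd).
    unfold G', shifted; rewrite (Hk0 t Ht3).
    pose proof (f_equal X1 E) as E1; pose proof (f_equal X2 E) as E2;
      pose proof (f_equal X3 E) as E3.
    rewrite !X1_minus in E1; rewrite !X2_minus in E2; rewrite !X3_minus in E3.
    apply R3_ext; unfold r; r3_simpl; lra. }
  assert (Hright : forall e t, 0 <= t <= L -> L - d <= t -> L - L / 3 <= t -> G' e t = g t).
  { intros e t Ht Htd Ht3.
    assert (E := proj2 (Hends e t Ht) Htd).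
    unfold G', shifted; rewrite (Hk1 t Ht3).
    pose proof (f_equal X1 E) as E1; pose proof (f_equal X2 E) as E2;
      pose proof (f_equal X3 E) as E3.
    rewrite !X1_minus in E1; rewrite !X2_minus in E2; rewrite !X3_minus in E3.
    apply R3_ext; unfold r, b, w; r3_simpl; lra. }
  assert (Hfix : fixed_ends_variation L g G').
  { assert (Hz : forall u v w z : R3, u = v -> w = z -> minus u v = minus w z).
    { intros u v ? ? -> ->; apply R3_ext; r3_simpl; ring. }
    split.
    - split; [easy|]; split; [easy|].
      exists (Rmin d (L / 3)).
      pose proof (Rmin_l d (L / 3)); pose proof (Rmin_r d (L / 3)).
      split; [apply Rmin_pos; lra|].
      intros e t Ht; split; intros Htd; apply Hz.
      + apply Hleft; lra.
      + apply Hleft; lra.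
      + apply Hright; lra.
      + apply Hright; lra.
    - intros e; split; [apply Hleft; lra|apply Hright; lra]. }
  assert (Hd0 := Hcrit G' Hfix).
  assert (HdG' := is_derive_Sadowsky mu L m g HL Hm Hg HA HB G' HG's HG'0).
  assert (Hzero : RInt (d1 (family_density mu m G') 0) 0 L = 0).
  { rewrite <- (is_derive_unique _ _ _ HdG'); now apply is_derive_unique. }
  set (a := D w 0).
  set (dG := d1 (family_density mu m G) 0).
  assert (HdG : smooth dG).
  { apply (smooth2_slice (d1 (family_density mu m G))).
    now apply smooth2_d1, smooth2_family_density. }
  (* The velocity of [b] at 0 is [- a], and the translation [r] contributes nothing to derivatives
     in [t]. The velocities for [G'] therefore differ from those for [G] by [- a] times derivatives
     of [k], and splitting [a] along the coordinate vectors gives multiples of the velocities of the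
     [K] families. *)
  assert (Hlin : RInt (d1 (family_density mu m G') 0) 0 L
    = RInt dG 0 L + (- X1 a * I e1 + - X2 a * I e2 + - X3 a * I e3)).
  { assert (Hc : forall x u, smooth (fun t => x * dK u t))
      by (intros x u; exact (smooth_mult _ _ (smooth_const x) (HdK u))).
    assert (Hc2 := smooth_plus _ _ (Hc (- X1 a) e1) (Hc (- X2 a) e2)).
    assert (Hc3 := smooth_plus _ _ Hc2 (Hc (- X3 a) e3)).
    unfold I; rewrite <- (RInt_mul _ 0 L (- X1 a) (HdK e1)),
      <- (RInt_mul _ 0 L (- X2 a) (HdK e2)), <- (RInt_mul _ 0 L (- X3 a) (HdK e3)).
    rewrite <- (RInt_add _ _ 0 L (Hc (- X1 a) e1) (Hc (- X2 a) e2)).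
    rewrite <- (RInt_add _ _ 0 L Hc2 (Hc (- X3 a) e3)).
    rewrite <- (RInt_add _ _ 0 L HdG Hc3).
    apply RInt_ext; intros t; rewrite Rmin_left, Rmax_right by lra; intros Ht.
    destruct (d1_family_density mu L m g Hm) as (cA & cB & cd & Hv).
    unfold dG, dK.
    rewrite (Hv G' HG's HG'0 t Ht), (Hv G HGs HG0 t Ht).
    rewrite !(fun u => Hv (K u) (HK u) (HK0 u) t Ht).
    destruct (shifted_velocities G r b k t HGs Hb Hk) as (V1 & V2 & V3).
    fold G' in V1, V2, V3; rewrite V1, V2, V3; clear V1 V2 V3.
    assert (HKv : forall u,
      D (fun e => D (K u e) t) 0 = plus z (scal (Derive k t) u) /\
      D (fun e => D (D (K u e)) t) 0 = plus z (scal (Derive (Derive k) t) u) /\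
      D (fun e => D (D (D (K u e))) t) 0
        = plus z (scal (Derive (Derive (Derive k)) t) u)).
    { intros u.
      pose proof (shifted_velocities (fun _ => g) (fun _ => z) (fun e => scal e u) k t
        (smooth_family_const g Hg) (smooth_curve_scal_id u) Hk) as Hs.
      rewrite D_scal_id, !D_constant in Hs; exact Hs. }
    destruct (HKv e1) as (-> & -> & ->), (HKv e2) as (-> & -> & ->),
      (HKv e3) as (-> & -> & ->).
    assert (Hb' : D b 0 = scal (-1) a).
    { unfold b; now rewrite D_minus_l. }
    rewrite Hb'; unfold first_variation, det3.
    generalize (D (fun e => D (G e) t) 0) (D (fun e => D (D (G e)) t) 0)
      (D (fun e => D (D (D (G e))) t) 0) a (D g t) (D (D g) t) (D (D (D g)) t).
    intros v1 v2 v3 c p q s; r3_simpl.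
    unfold z, e1, e2, e3; unfold X1, X2, X3; simpl; ring. }
  assert (Hdot : is_derive (fun e => dot (- I e1, - I e2, - I e3) (w e)) 0
                   (dot (- I e1, - I e2, - I e3) a)).
  { replace (dot (- I e1, - I e2, - I e3) a)
      with (Derive (fun e => dot (- I e1, - I e2, - I e3) (w e)) 0).
    - apply Derive_correct, smooth_ex_derive, smooth_dot; [exact (smooth_curve_const _)|easy].
    - rewrite (Derive_dot (fun _ => (- I e1, - I e2, - I e3)) w);
        [|apply smooth_curve_diff, smooth_curve_const|now apply smooth_curve_diff].
      rewrite D_constant; unfold a, dot, X1, X2, X3; simpl; ring. }
  assert (HdGS := is_derive_Sadowsky mu L m g HL Hm Hg HA HB G HGs HG0).
  replace 0 with (RInt dG 0 L + dot (- I e1, - I e2, - I e3) a) at 2.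
  - exact (is_derive_plus _ _ _ _ _ HdGS Hdot).
  - rewrite Hlin in Hzero; rewrite <- Hzero at 2.
    unfold dot, X1, X2, X3; simpl; ring.
Qed.

(** * Variations prescribed by their velocity *)

Definition curve_of_velocity (g0 : R3) (H : R -> R -> R3) (e t : R) : R3 :=
  (X1 g0 + RInt (fun u => X1 (H e u)) 0 t,
   X2 g0 + RInt (fun u => X2 (H e u)) 0 t,
   X3 g0 + RInt (fun u => X3 (H e u)) 0 t).

Lemma smooth_curve_of_velocity (g0 : R3) (H : R -> R -> R3) :
  smooth_family H -> smooth_family (curve_of_velocity g0 H).
Proof.
  assert (A : forall x f, smooth2 f -> smooth2 (fun e t => x + RInt (f e) 0 t)).
  { intros x f Hf; apply smooth2_plus; [apply smooth2_const|].
    now apply smooth2_primitive. }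
  intros (H1 & H2 & H3); split; [|split].
  - exact (A _ _ H1).
  - exact (A _ _ H2).
  - exact (A _ _ H3).
Qed.

Lemma D_curve_of_velocity (g0 : R3) (H : R -> R -> R3) (e : R) :
  smooth_family H -> D (curve_of_velocity g0 H e) = H e.
Proof.
  assert (A : forall x f t, smooth f -> Derive (fun t => x + RInt f 0 t) t = f t).
  { intros x f t Hf.
    assert (Hd := is_derive_RInt_smooth f 0 t Hf).
    rewrite Derive_plus; [|apply ex_derive_const|now exists (f t)].
    rewrite Derive_const, Rplus_0_l; now apply is_derive_unique. }
  intros HH; destruct (smooth_family_slice H e HH) as (H1 & H2 & H3).
  extensionality t; apply R3_ext; [exact (A _ _ t H1)|exact (A _ _ t H2)|exact (A _ _ t H3)].
Qed.

Lemma RInt_eq_increment (f h : R -> R) (a b : R) :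
  smooth h -> a <= b -> (forall u, a < u < b -> f u = Derive h u) -> RInt f a b = h b - h a.
Proof.
  intros Hh Hab H; rewrite <- (RInt_Derive h).
  - apply RInt_ext; rewrite Rmin_left, Rmax_right by easy; easy.
  - intros x _; now apply smooth_ex_derive.
  - intros x _; now apply smooth_continuous, smooth_Derive.
Qed.

Lemma curve_of_velocity_eq (g : R -> R3) (H : R -> R -> R3) (e t : R) :
  smooth_curve g -> 0 <= t -> (forall u, 0 < u < t -> H e u = D g u) ->
  curve_of_velocity (g 0) H e t = g t.
Proof.
  intros (H1 & H2 & H3) Ht HH; unfold curve_of_velocity.
  rewrite (RInt_eq_increment _ (fun u => X1 (g u)) 0 t H1 Ht) by (intros u Hu; now rewrite HH).
  rewrite (RInt_eq_increment _ (fun u => X2 (g u)) 0 t H2 Ht) by (intros u Hu; now rewrite HH).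
  rewrite (RInt_eq_increment _ (fun u => X3 (g u)) 0 t H3 Ht) by (intros u Hu; now rewrite HH).
  apply R3_ext; unfold X1 at 1, X2 at 1, X3 at 1; simpl; ring.
Qed.

Lemma curve_of_velocity_end (g : R -> R3) (H : R -> R -> R3) (e t L : R) :
  smooth_curve g -> smooth_family H -> t <= L -> (forall u, t < u < L -> H e u = D g u) ->
  minus (curve_of_velocity (g 0) H e t) (g t) = minus (curve_of_velocity (g 0) H e L) (g L).
Proof.
  intros (H1 & H2 & H3) HHs Ht HH.
  destruct (smooth_family_slice H e HHs) as (S1 & S2 & S3).
  unfold curve_of_velocity.
  rewrite (RInt_split _ 0 t L S1), (RInt_split _ 0 t L S2), (RInt_split _ 0 t L S3).
  rewrite (RInt_eq_increment _ (fun u => X1 (g u)) t L H1 Ht) by (intros u Hu; now rewrite HH).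
  rewrite (RInt_eq_increment _ (fun u => X2 (g u)) t L H2 Ht) by (intros u Hu; now rewrite HH).
  rewrite (RInt_eq_increment _ (fun u => X3 (g u)) t L H3 Ht) by (intros u Hu; now rewrite HH).
  apply R3_ext; r3_simpl; unfold X1 at 1 5, X2 at 1 5, X3 at 1 5; simpl; ring.
Qed.

(** Where the velocity is that of [g], the curve is a translate of [g]: unmoved at the start, where
    the initial point is kept, and shifted at the end by whatever the integral has accumulated in
    between. *)
Lemma curve_of_velocity_variation (L : R) (g : R -> R3) (H : R -> R -> R3) (d : R) :
  smooth_curve g -> smooth_family H -> 0 < L -> 0 < d ->
  (forall t, 0 < t < L -> H 0 t = D g t) ->
  (forall e t, 0 < t < L -> t < d \/ L - d < t -> H e t = D g t) ->
  variation L g (curve_of_velocity (g 0) H).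
Proof.
  intros Hg HH HL Hd H0 Hends; split; [now apply smooth_curve_of_velocity|].
  split.
  - intros t Ht; apply curve_of_velocity_eq; [easy|lra|].
    intros u Hu; apply H0; lra.
  - exists d; split; [easy|]; intros e t Ht; split; intros Htd.
    + rewrite (curve_of_velocity_eq g H e t Hg (proj1 Ht))
        by (intros u Hu; apply Hends; lra).
      rewrite (curve_of_velocity_eq g H e 0 Hg (Rle_refl 0)) by (intros u Hu; lra).
      apply R3_ext; r3_simpl; ring.
    + apply (curve_of_velocity_end g H e t L Hg HH (proj2 Ht)).
      intros u Hu; apply Hends; lra.
Qed.

(** This turns the multiplier term into an integral over [0, L], so that it can be merged with the
    Sadowsky integrand. *)
Lemma dot_curve_of_velocity (b g0 : R3) (H : R -> R -> R3) (e L : R) :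
  smooth_family H ->
  dot b (minus (curve_of_velocity g0 H e L) (curve_of_velocity g0 H e 0))
  = RInt (fun t => dot b (H e t)) 0 L.
Proof.
  intros HH; destruct (smooth_family_slice H e HH) as (H1 & H2 & H3).
  assert (Hc : forall x f, smooth f -> smooth (fun t : R => x * f t))
    by (intros x f Hf; apply smooth_mult; [apply smooth_const|easy]).
  unfold dot at 2.
  assert (S1 := Hc (X1 b) _ H1); assert (S2 := Hc (X2 b) _ H2); assert (S3 := Hc (X3 b) _ H3).
  rewrite (RInt_add (fun t => X1 b * X1 (H e t) + X2 b * X2 (H e t)) (fun t => X3 b * X3 (H e t)));
    [|now apply smooth_plus|easy].
  rewrite (RInt_add (fun t => X1 b * X1 (H e t)) (fun t => X2 b * X2 (H e t))) by easy.
  rewrite !RInt_mul by easy.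
  unfold curve_of_velocity; r3_simpl; rewrite !RInt_point.
  change (zero : R) with 0; cbn [X1 X2 X3 fst snd]; ring.
Qed.

(** * The Euler-Lagrange equation for variations of the speed, and two tools for the comparison *)

Lemma gram_scaled_velocity (g h : R -> R3) (w : R -> R) (t : R) :
  smooth_curve g -> smooth w -> D h = (fun u => scal (w u) (D g u)) ->
  gram1 h t = w t ^ 2 * gram1 g t /\ gram2 h t = w t ^ 4 * gram2 g t /\
  triple h t = w t ^ 3 * triple g t.
Proof.
  intros Hg Hw E.
  assert (Hg1 := smooth_curve_D g Hg); assert (Hg2 := smooth_curve_D _ Hg1).
  assert (Hw1 := smooth_Derive w Hw).
  assert (E2 : D (D h) = fun u => plus (scal (Derive w u) (D g u)) (scal (w u) (D (D g) u))).
  { rewrite E; extensionality u; apply D_scal;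
      [now apply smooth_ex_derive|now apply smooth_curve_diff]. }
  assert (E3 : D (D (D h)) t = plus
    (plus (scal (Derive (Derive w) t) (D g t)) (scal (Derive w t) (D (D g) t)))
    (plus (scal (Derive w t) (D (D g) t)) (scal (w t) (D (D (D g)) t)))).
  { rewrite E2, D_plus; [|now apply smooth_curve_diff, smooth_curve_scal
                         |now apply smooth_curve_diff, smooth_curve_scal].
    rewrite !D_scal; try (now apply smooth_ex_derive); try (now apply smooth_curve_diff).
    reflexivity. }
  unfold gram1, gram2, triple, det3; rewrite E3, E2, E; split; [|split]; r3_simpl; ring.
Qed.

Ltac eq_R := match goal with |- @eq _ ?a ?b => change (@eq R a b) end.

Lemma smooth_sadowsky_density (m mu : R) (A B d : R -> R) :
  0 < m -> smooth A -> smooth B -> smooth d ->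
  smooth (fun t => sadowsky_density m mu (A t) (B t) (d t)).
Proof.
  intros Hm HA HB Hd.
  exact (smooth2_slice _ 0 (smooth2_sadowsky_density m mu _ _ _ Hm
    (smooth2_snd A HA) (smooth2_snd B HB) (smooth2_snd d Hd))).
Qed.

Lemma RInt_nonneg_zero (f : R -> R) (a b t : R) :
  smooth f -> (forall u, 0 <= f u) -> RInt f a b = 0 -> a < t < b -> f t = 0.
Proof.
  intros Hf H0 HI Ht; destruct (Rle_lt_or_eq_dec _ _ (H0 t)) as [E|E]; [exfalso|easy].
  destruct (continuous_locally_gt f t 0 (smooth_continuous f t Hf) E) as [d Hd].
  set (r := Rmin (d / 2) (Rmin (t - a) (b - t))).
  assert (Hd0 := cond_pos d).
  pose proof (Rmin_l (d / 2) (Rmin (t - a) (b - t))).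
  pose proof (Rmin_r (d / 2) (Rmin (t - a) (b - t))).
  pose proof (Rmin_l (t - a) (b - t)); pose proof (Rmin_r (t - a) (b - t)).
  assert (Hr : 0 < r) by (apply Rmin_pos; [lra|apply Rmin_pos; lra]).
  fold r in H, H1.
  rewrite (RInt_split f a (t - r) b), (RInt_split f (t - r) (t + r) b) in HI by easy.
  assert (I1 : 0 <= RInt f a (t - r)).
  { apply RInt_ge_0; [lra|now apply smooth_ex_RInt|easy]. }
  assert (I2 : 0 <= RInt f (t + r) b).
  { apply RInt_ge_0; [lra|now apply smooth_ex_RInt|easy]. }
  assert (I3 : 0 < RInt f (t - r) (t + r)).
  { apply RInt_gt_0; [lra| |intros x _; now apply smooth_continuous].
    intros x Hx; apply Hd; change (Rabs (x - t) < d); apply Rabs_def1; lra. }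
  lra.
Qed.

(** The test function is [p * h] with a bump [p] that is positive at [t] and vanishes near the ends.
    The integrand [p * h^2] is then nonnegative with integral 0, hence vanishes at [t]. *)
Lemma fundamental_lemma (h : R -> R) (a b : R) :
  smooth h ->
  (forall k d, smooth k -> 0 < d -> (forall t, t < a + d \/ b - d < t -> k t = 0) ->
     RInt (fun t => k t * h t) a b = 0) ->
  forall t, a < t < b -> h t = 0.
Proof.
  intros Hh H t Ht.
  set (d := Rmin (t - a) (b - t) / 2).
  assert (Hd : 0 < d /\ a + d < t /\ t < b - d).
  { assert (0 < Rmin (t - a) (b - t)) by (apply Rmin_pos; lra).
    pose proof (Rmin_l (t - a) (b - t)); pose proof (Rmin_r (t - a) (b - t)); unfold d; lra. }
  set (p := fun u => flat 0 (u - (a + d)) * flat 0 (b - d - u)).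
  assert (Hp : smooth p).
  { apply (smooth_mult (fun u => flat 0 (u - (a + d))) (fun u => flat 0 (b - d - u))).
    - apply (smooth_comp (flat 0) (fun u => u - (a + d))); [apply smooth_flat|].
      exact (smooth_minus _ _ smooth_id (smooth_const (a + d))).
    - apply (smooth_comp (flat 0) (fun u => b - d - u)); [apply smooth_flat|].
      exact (smooth_minus _ _ (smooth_const (b - d)) smooth_id). }
  assert (Hph := smooth_mult p h Hp Hh).
  assert (E : (fun u => p u * h u * h u) t = 0).
  { apply (RInt_nonneg_zero (fun u => p u * h u * h u) a b);
      [exact (smooth_mult _ _ Hph Hh)| | |easy].
    - intros u; rewrite Rmult_assoc; apply Rmult_le_pos; [|nra].
      apply Rmult_le_pos; apply flat_nonneg.
    - apply (H (fun u => p u * h u) d); [easy|lra|].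
      intros u Hu; unfold p; destruct Hu as [Hu|Hu].
      + rewrite (flat_nonpos 0 (u - (a + d))) by lra; ring.
      + rewrite (flat_nonpos 0 (b - d - u)) by lra; ring. }
  simpl in E.
  assert (Hpt : 0 < p t) by (apply Rmult_lt_0_compat; apply flat_pos; lra).
  assert (h t * h t = 0); [|nra].
  apply Rmult_eq_reg_l with (p t); [|lra]; rewrite Rmult_0_r, <- E; ring.
Qed.

Lemma bending_scale (x A B d : R) :
  0 < x -> 0 < A -> 0 < B ->
  bending (x ^ 2 * A) (x ^ 4 * B) (x ^ 3 * d) = bending A B d / x ^ 2.
Proof. intros; unfold bending; field; lra. Qed.

(* Varying the speed and keeping the tangent image: gamma' is replaced by
   [exp (e * k) gamma'], which divides the squared curvature by [exp (2 * e * k)]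
   and preserves the modified torsion. *)
Lemma euler_lagrange_interior (mu L m : R) (g : R -> R3) (b0 : R3) :
  0 < L -> 0 < m -> smooth_curve g ->
  (forall t, 0 <= t <= L -> 3 * m <= gram1 g t) ->
  (forall t, 0 <= t <= L -> 3 * m <= gram2 g t) ->
  endpoint_multiplier mu L g b0 ->
  forall t, 0 < t < L ->
  dot b0 (D g t) - mu * csqrt m (gram1 g t)
  = sadowsky_density m 0 (gram1 g t) (gram2 g t) (triple g t).
Proof.
  intros HL Hm Hg HA HB Hmult t0 Ht0.
  (* On [0, L], [X] is [kappa^2 (1 + lambda^2)^2] times the speed, and [Y] collects the multiplier
     terms for end points and length, both proportional to the speed. *)
  set (X := fun t => sadowsky_density m 0 (gram1 g t) (gram2 g t) (triple g t)).
  set (Y := fun t => dot b0 (D g t) - mu * csqrt m (gram1 g t)).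
  assert (HX : smooth X).
  { apply smooth_sadowsky_density; [easy|now apply smooth_gram1
      |now apply smooth_gram2|now apply smooth_triple]. }
  assert (Hr : smooth (fun t => csqrt m (gram1 g t))).
  { apply (smooth_comp (csqrt m)); [now apply smooth_csqrt|now apply smooth_gram1]. }
  assert (Hb : smooth (fun t => dot b0 (D g t))).
  { apply smooth_dot; [exact (smooth_curve_const b0)|now apply smooth_curve_D]. }
  assert (Hmr := smooth_mult _ _ (smooth_const mu) Hr).
  assert (HY : smooth Y) by exact (smooth_minus _ _ Hb Hmr).
  assert (HYX : smooth (fun t => Y t - X t)) by exact (smooth_minus _ _ HY HX).
  assert (E : (fun t => Y t - X t) t0 = 0); [|simpl in E; unfold X, Y in E; lra].
  apply (fundamental_lemma (fun t => Y t - X t) 0 L HYX); [|easy].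
  intros k d Hk Hd Hk0.
  set (w := fun e t => exp (e * k t)).
  assert (Hek : smooth2 (fun e t => e * k t))
    by exact (smooth2_mult _ _ (smooth2_fst _ smooth_id) (smooth2_snd k Hk)).
  assert (Hw : smooth2 w) by exact (smooth2_comp1 exp _ smooth_exp Hek).
  assert (Hw' : smooth2 (fun e t => exp (- (e * k t))))
    by exact (smooth2_comp1 exp _ smooth_exp (smooth2_opp _ Hek)).
  set (H := fun e t => scal (w e t) (D g t)).
  assert (HH : smooth_family H).
  { apply (smooth_family_scal w (fun _ => D g) Hw).
    now apply smooth_family_const, smooth_curve_D. }
  set (G := curve_of_velocity (g 0) H).
  assert (HG : variation L g G).
  { apply (curve_of_velocity_variation L g H d Hg HH HL Hd).
    - intros t _; unfold H, w; rewrite Rmult_0_l, exp_0.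
      apply R3_ext; r3_simpl; ring.
    - intros e t Ht Htd; unfold H, w; rewrite Hk0 by lra.
      rewrite Rmult_0_r, exp_0; apply R3_ext; r3_simpl; ring. }
  (* Multiplying the speed by [w] divides the squared curvature by [w^2], so [X] acquires the factor
     [1 / w] and [Y] the factor [w]. The derivative at 0 is therefore [k * (Y - X)]. *)
  set (F := fun e t => X t * exp (- (e * k t)) + Y t * w e t).
  assert (HF : smooth2 F).
  { exact (smooth2_plus _ _ (smooth2_mult _ _ (smooth2_snd X HX) Hw')
      (smooth2_mult _ _ (smooth2_snd Y HY) Hw)). }
  assert (HE : forall e, Sadowsky mu L (G e) + dot b0 (minus (G e L) (G e 0)) = RInt (F e) 0 L).
  { intros e; unfold G at 2 3; rewrite dot_curve_of_velocity by easy.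
    set (S := fun t => X t * exp (- (e * k t)) - mu * csqrt m (gram1 g t) * w e t).
    assert (HS : smooth S).
    { exact (smooth_minus _ _ (smooth_mult _ _ HX (smooth2_slice _ e Hw'))
        (smooth_mult _ _ Hmr (smooth2_slice _ e Hw))). }
    replace (Sadowsky mu L (G e)) with (RInt S 0 L).
    - rewrite <- (RInt_add S (fun t => dot b0 (H e t))); [|easy|].
      + apply RInt_ext; intros t _; unfold F, S, Y, H; r3_simpl; eq_R; ring.
      + apply smooth_dot; [exact (smooth_curve_const b0)|now apply smooth_family_slice].
    - apply RInt_ext; intros t; rewrite Rmin_left, Rmax_right by lra; intros Ht.
      destruct (gram_scaled_velocity g (G e) (w e) t Hg (smooth2_slice _ e Hw)
        (D_curve_of_velocity (g 0) H e HH)) as (E1 & E2 & E3).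
      assert (HA' := HA t ltac:(lra)); assert (HB' := HB t ltac:(lra)).
      assert (Hx : 0 < w e t) by apply exp_pos.
      rewrite Sadowsky_integrand_eq;
        [|now apply smooth_family_slice, smooth_curve_of_velocity
         |rewrite E1; apply Rmult_lt_0_compat; [now apply pow_lt|lra]
         |rewrite E2; apply Rmult_lt_0_compat; [now apply pow_lt|lra]].
      rewrite E1, E2, E3, bending_scale by (try easy; lra).
      rewrite sqrt_mult_alt by (apply pow_le; lra).
      rewrite sqrt_pow2 by lra.
      unfold S, X; rewrite sadowsky_density_eq, csqrt_eq by (try easy; lra).
      rewrite exp_Ropp; fold (w e t); eq_R; field; lra. }
  assert (HdF := is_derive_RInt_smooth2 F 0 L 0 HF).
  assert (Hzero := Hmult G HG).
  assert (Hz : RInt (d1 F 0) 0 L = 0).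
  { transitivity (Derive (fun e => RInt (F e) 0 L) 0);
      [symmetry; exact (is_derive_unique _ _ _ HdF)|apply is_derive_unique].
    apply (is_derive_ext (fun e => Sadowsky mu L (G e) + dot b0 (minus (G e L) (G e 0))));
      [exact HE|exact Hzero]. }
  transitivity (RInt (d1 F 0) 0 L); [|exact Hz].
  apply RInt_ext; intros t _.
  assert (Hd1 : is_derive (fun e => X t * exp (- (e * k t)) + Y t * exp (e * k t)) 0
                  (k t * (Y t - X t))).
  { auto_derive; [easy|]; rewrite !Rmult_0_l, Ropp_0, exp_0; ring. }
  symmetry; exact (is_derive_unique _ _ _ Hd1).
Qed.

(** Divided by the speed this reads [kappa^2 (1 + lambda^2)^2 = <T, b0> - mu]. The interior identity
    is extended to the ends in its clamped form, where both sides are smooth on the whole line. *)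
Lemma euler_lagrange (mu L m : R) (g : R -> R3) (b0 : R3) :
  0 < L -> 0 < m -> smooth_curve g ->
  (forall t, 0 <= t <= L -> 3 * m <= gram1 g t) ->
  (forall t, 0 <= t <= L -> 3 * m <= gram2 g t) ->
  endpoint_multiplier mu L g b0 ->
  forall t, 0 <= t <= L ->
  dot b0 (D g t) = (bending (gram1 g t) (gram2 g t) (triple g t) + mu) * sqrt (gram1 g t).
Proof.
  intros HL Hm Hg HA HB Hmult t Ht.
  assert (E : dot b0 (D g t) - mu * csqrt m (gram1 g t)
    = sadowsky_density m 0 (gram1 g t) (gram2 g t) (triple g t)).
  { apply (smooth_eq_closure (fun t => dot b0 (D g t) - mu * csqrt m (gram1 g t))
      (fun t => sadowsky_density m 0 (gram1 g t) (gram2 g t) (triple g t)) 0 L t).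
    - apply (smooth_minus (fun t => dot b0 (D g t)) (fun t => mu * csqrt m (gram1 g t))).
      + apply smooth_dot; [exact (smooth_curve_const b0)|now apply smooth_curve_D].
      + apply (smooth_mult (fun _ => mu) (fun t => csqrt m (gram1 g t))); [apply smooth_const|].
        apply (smooth_comp (csqrt m)); [now apply smooth_csqrt|now apply smooth_gram1].
    - apply smooth_sadowsky_density; [easy|now apply smooth_gram1
        |now apply smooth_gram2|now apply smooth_triple].
    - easy.
    - easy.
    - now apply (euler_lagrange_interior mu L m g b0). }
  specialize (HA t Ht); specialize (HB t Ht).
  rewrite csqrt_eq, sadowsky_density_eq in E by (try easy; lra); lra.
Qed.

(** [E - P] is nonnegative near [x] and zero at [x], so it has a local minimum there and its
    derivative [0 - l] vanishes. *)
Lemma tangency_derivative (E P : R -> R) (x l : R) :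
  is_derive E x 0 -> is_derive P x l -> locally x (fun e => P e <= E e) -> E x = P x -> l = 0.
Proof.
  intros HE HP [d Hd] Hx.
  assert (Hh : is_derive (fun e => E e - P e) x (0 - l)) by exact (is_derive_minus _ _ _ _ _ HE HP).
  assert (Hd0 := cond_pos d).
  assert (pr : derivable_pt (fun e => E e - P e) x)
    by (apply ex_derive_Reals_0; now exists (0 - l)).
  assert (Hm : derive_pt (fun e => E e - P e) x pr = 0).
  { apply (deriv_minimum _ (x - d) (x + d)); [lra|lra|].
    intros y Hy1 Hy2; rewrite Hx.
    assert (P y <= E y); [|lra].
    apply Hd; change (Rabs (y - x) < d); apply Rabs_def1; lra. }
  assert (Hu : Derive (fun e => E e - P e) x = 0 - l) by exact (is_derive_unique _ _ _ Hh).
  rewrite Derive_Reals, Hu in Hm; lra.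
Qed.

(** The base of the square is [kappa (1 + lambda^2)]: for a curve of speed [v] whose tangent image
    is [c] composed with [s], where [n] is the squared speed of [c], the curvature is
    [sqrt n * s' / v] and [d / n^(3/2)] is the geodesic curvature of [c]. *)
Lemma bending_spherical (v s' n d : R) :
  0 < v -> 0 < s' -> 0 < n ->
  bending (v ^ 2) (v ^ 4 * s' ^ 2 * n) (v ^ 3 * s' ^ 3 * d)
  = (sqrt n * s' / v * (1 + d ^ 2 / n ^ 3)) ^ 2.
Proof.
  intros Hv Hs Hn; unfold bending.
  assert (Q := sqrt_def n (Rlt_le _ _ Hn)); assert (Hq := sqrt_lt_R0 n Hn).
  set (q := sqrt n) in *; rewrite <- Q; field; lra.
Qed.

(** * Reparametrization by the arclength of the tangent image *)

(** On [0, L] this is [kappa v], the speed of the tangent image. Clamping makes it smooth and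
    positive on the whole line, so that its primitive is a smooth, strictly increasing change of
    parameter. *)
Definition tangent_speed (m : R) (g : R -> R3) (t : R) : R :=
  csqrt m (gram2 g t) * cinv m (gram1 g t).

Definition tangent_length (m : R) (g : R -> R3) (t : R) : R :=
  RInt (tangent_speed m g) 0 t.

Section Reparametrization.

Variables (L m : R) (g : R -> R3).
Hypothesis HL : 0 < L.
Hypothesis Hm : 0 < m.
Hypothesis Hg : smooth_curve g.
Hypothesis HA : forall t, 0 <= t <= L -> 3 * m <= gram1 g t.
Hypothesis HB : forall t, 0 <= t <= L -> 3 * m <= gram2 g t.

Let s := tangent_length m g.

Lemma smooth_tangent_speed : smooth (tangent_speed m g).
Proof.
  apply (smooth_mult (fun t => csqrt m (gram2 g t)) (fun t => cinv m (gram1 g t))).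
  - apply (smooth_comp (csqrt m)); [now apply smooth_csqrt|now apply smooth_gram2].
  - apply (smooth_comp (cinv m)); [now apply smooth_cinv|now apply smooth_gram1].
Qed.

Lemma tangent_speed_pos (t : R) : 0 < tangent_speed m g t.
Proof.
  apply Rmult_lt_0_compat; [now apply csqrt_pos|].
  now apply Rinv_0_lt_compat, clamp_pos.
Qed.

Lemma is_derive_tangent_length (t : R) : is_derive s t (tangent_speed m g t).
Proof. apply is_derive_RInt_smooth, smooth_tangent_speed. Qed.

Lemma smooth_tangent_length : smooth s.
Proof. apply smooth_primitive, smooth_tangent_speed. Qed.

Lemma tangent_length_incr (a b : R) : a < b -> s a < s b.
Proof.
  intros Hab; unfold s, tangent_length.
  rewrite (RInt_split _ 0 a b smooth_tangent_speed).
  assert (0 < RInt (tangent_speed m g) a b); [|lra].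
  apply RInt_gt_0; [easy|intros; apply tangent_speed_pos|].
  intros x _; apply smooth_continuous, smooth_tangent_speed.
Qed.

Lemma tangent_length_0 : s 0 = 0.
Proof. unfold s, tangent_length; now rewrite RInt_point. Qed.

Lemma tangent_length_range (t : R) : 0 <= t <= L -> 0 <= s t <= s L.
Proof.
  intros Ht; rewrite <- tangent_length_0 at 1; split.
  - destruct (Req_dec t 0) as [->|]; [lra|apply Rlt_le, tangent_length_incr; lra].
  - destruct (Req_dec t L) as [->|]; [lra|apply Rlt_le, tangent_length_incr; lra].
Qed.

Lemma tangent_length_range_open (t : R) : 0 < t < L -> 0 < s t < s L.
Proof.
  intros Ht; rewrite <- tangent_length_0 at 1; split; apply tangent_length_incr; lra.
Qed.

Lemma tangent_length_onto (x : R) : 0 <= x <= s L -> exists t, 0 <= t <= L /\ s t = x.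
Proof.
  intros Hx; assert (H0 := tangent_length_0).
  destruct (IVT_gen s 0 L x) as (t & Ht & E).
  - intros t; apply continuity_pt_filterlim, (smooth_continuous s t smooth_tangent_length).
  - rewrite Rmin_left, Rmax_right; lra.
  - rewrite Rmin_left, Rmax_right in Ht by lra; now exists t.
Qed.

Lemma tangent_speed_eq (t : R) :
  0 <= t <= L -> tangent_speed m g t = sqrt (gram2 g t) / gram1 g t.
Proof.
  intros Ht; specialize (HA t Ht); specialize (HB t Ht).
  unfold tangent_speed; now rewrite csqrt_eq, cinv_eq by (try easy; lra).
Qed.

Lemma arclength_tangent_eq (t : R) : 0 <= t <= L -> arclength (tangent g) t = s t.
Proof.
  intros Ht; apply RInt_ext; intros u; rewrite Rmin_left, Rmax_right by lra; intros Hu.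
  assert (Hu' : 0 <= u <= L) by lra.
  rewrite tangent_speed_eq by easy; specialize (HA u Hu').
  assert (HA' : 0 < gram1 g u) by lra.
  pose proof (curvature_eq g u Hg HA') as Hc.
  assert (Hs := sqrt_lt_R0 _ HA').
  unfold curvature in Hc; change (speed g u) with (sqrt (gram1 g u)) in Hc.
  unfold speed.
  replace (norm3 (D (tangent g) u))
    with (norm3 (D (tangent g) u) / sqrt (gram1 g u) * sqrt (gram1 g u)) by (field; lra).
  rewrite Hc; eq_R; field; lra.
Qed.

Variable T : R -> R3.
Hypothesis HT : smooth_curve T.
Hypothesis HTs : forall t, 0 <= t <= L -> T (s t) = tangent g t.

Lemma velocity_of_tangent (t : R) :
  0 <= t <= L -> D g t = scal (csqrt m (gram1 g t)) (T (s t)).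
Proof.
  intros Ht; rewrite HTs by easy; specialize (HA t Ht).
  rewrite csqrt_eq by (try easy; lra).
  assert (HA' : 0 < gram1 g t) by lra; assert (Hs := sqrt_lt_R0 _ HA').
  unfold tangent; change (speed g t) with (sqrt (gram1 g t)).
  apply R3_ext; r3_simpl; field; lra.
Qed.

Lemma tangent_image_unit (x : R) : 0 <= x <= s L -> dot (T x) (T x) = 1.
Proof.
  intros Hx; destruct (tangent_length_onto x Hx) as (t & Ht & <-).
  rewrite HTs by easy; specialize (HA t Ht).
  apply norm3_inv_scal; change (0 < gram1 g t); lra.
Qed.

Lemma unit_family_orthogonal (l : R) (c : R -> R3) (x : R) :
  smooth_curve c -> (forall x, 0 <= x <= l -> dot (c x) (c x) = 1) -> 0 < x < l ->
  dot (c x) (D c x) = 0.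
Proof.
  intros Hc H Hx; apply unit_orthogonal; [now apply smooth_curve_diff|].
  apply filter_imp with (2 := locally_Ioo 0 l x Hx); intros u Hu; apply H; lra.
Qed.

(* Curves of velocity [v (c o s)], with [v] the speed of [g]: [c = T] gives back
   [g] up to translation, and [c] near [T] the variations that keep the speed. *)
Lemma spherical_grams (h c : R -> R3) (t : R) :
  smooth_curve c -> (forall x, 0 <= x <= s L -> dot (c x) (c x) = 1) -> 0 < t < L ->
  (forall u, 0 <= u <= L -> D h u = scal (csqrt m (gram1 g u)) (c (s u))) ->
  gram1 h t = csqrt m (gram1 g t) ^ 2 /\
  gram2 h t = csqrt m (gram1 g t) ^ 4 * tangent_speed m g t ^ 2 * gram1 c (s t) /\
  triple h t = csqrt m (gram1 g t) ^ 3 * tangent_speed m g t ^ 3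
               * det3 (c (s t)) (D c (s t)) (D (D c) (s t)).
Proof.
  intros Hc H1 Ht Hh.
  rewrite <- (is_derive_unique _ _ _ (is_derive_tangent_length t)).
  apply (gram_of_spherical h c (fun t => csqrt m (gram1 g t)) s).
  - easy.
  - apply (smooth_comp (csqrt m)); [now apply smooth_csqrt|now apply smooth_gram1].
  - exact smooth_tangent_length.
  - apply filter_imp with (2 := locally_Ioo 0 L t Ht); intros u Hu; apply Hh; lra.
  - apply H1, tangent_length_range; lra.
  - apply (unit_family_orthogonal (s L)); [easy|easy|].
    now apply tangent_length_range_open.
Qed.

(** Applied to [g] itself, [spherical_grams] expresses [gram2 g] as [gram2 g] times the squared
    speed of [T], which must therefore be 1 inside; continuity in [t] covers the ends. *)
Lemma tangent_image_arclength (x : R) : 0 <= x <= s L -> gram1 T x = 1.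
Proof.
  intros Hx; destruct (tangent_length_onto x Hx) as (t & Ht & <-).
  apply (smooth_eq_closure (fun t => gram1 T (s t)) (fun _ => 1) 0 L t); try easy.
  - apply (smooth_comp (gram1 T) s); [now apply smooth_gram1|exact smooth_tangent_length].
  - apply smooth_const.
  - intros u Hu; assert (Hu' : 0 <= u <= L) by lra.
    destruct (spherical_grams g T u HT tangent_image_unit Hu velocity_of_tangent)
      as (_ & E & _).
    rewrite tangent_speed_eq in E by easy.
    specialize (HA u Hu'); specialize (HB u Hu').
    rewrite csqrt_eq in E by (try easy; lra).
    assert (P1 : 0 < gram1 g u) by lra; assert (P2 : 0 < gram2 g u) by lra.
    assert (Hs1 := sqrt_lt_R0 _ P1).
    assert (Q1 := sqrt_def _ (Rlt_le _ _ P1)); assert (Q2 := sqrt_def _ (Rlt_le _ _ P2)).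
    set (x := gram1 T (s u)) in *.
    set (a := sqrt (gram1 g u)) in *; set (b := sqrt (gram2 g u)) in *.
    rewrite <- Q1 in E; apply Rmult_eq_reg_l with (gram2 g u); [|lra].
    rewrite Rmult_1_r; transitivity (a ^ 4 * (b / (a * a)) ^ 2 * x); [|symmetry; exact E].
    rewrite <- Q2; field; lra.
Qed.

Lemma geodesic_curvature_tangent (t : R) :
  0 <= t <= L -> geodesic_curvature T (s t) = modified_torsion g t.
Proof.
  intros Ht.
  assert (Hn := tangent_image_arclength (s t) (tangent_length_range t Ht)).
  rewrite geodesic_curvature_eq by (try easy; lra).
  rewrite Hn, sqrt_1, Rmult_1_l, Rdiv_1_r.
  rewrite modified_torsion_eq;
    [|easy|specialize (HA t Ht); lra|specialize (HB t Ht); lra].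
  (* The closed formula for the modified torsion with clamped roots and inverse: it is smooth on the
     whole line, so agreement inside [0, L] extends to the end points. *)
  set (K := fun t => triple g t * csqrt m (gram1 g t) ^ 3
                     * (csqrt m (gram2 g t) * cinv m (gram2 g t) ^ 2)).
  replace (triple g t * (gram1 g t * sqrt (gram1 g t)) / (gram2 g t * sqrt (gram2 g t)))
    with (K t).
  - apply (smooth_eq_closure (fun t => det3 (T (s t)) (D T (s t)) (D (D T) (s t))) K 0 L t);
      try easy.
    + assert (HT1 := smooth_curve_D T HT); assert (HT2 := smooth_curve_D _ HT1).
      apply (smooth_comp (fun x => det3 (T x) (D T x) (D (D T) x)) s);
        [|exact smooth_tangent_length].
      apply smooth_dot; [easy|now apply smooth_cross].
    + assert (S1 : smooth (fun t => csqrt m (gram1 g t)))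
        by (apply (smooth_comp (csqrt m)); [now apply smooth_csqrt|now apply smooth_gram1]).
      assert (S2 : smooth (fun t => csqrt m (gram2 g t)))
        by (apply (smooth_comp (csqrt m)); [now apply smooth_csqrt|now apply smooth_gram2]).
      assert (S3 : smooth (fun t => cinv m (gram2 g t)))
        by (apply (smooth_comp (cinv m)); [now apply smooth_cinv|now apply smooth_gram2]).
      exact (smooth_mult _ _ (smooth_mult _ _ (smooth_triple g Hg) (smooth_pow _ 3 S1))
        (smooth_mult _ _ S2 (smooth_pow _ 2 S3))).
    + intros u Hu; assert (Hu' : 0 <= u <= L) by lra.
      destruct (spherical_grams g T u HT tangent_image_unit Hu velocity_of_tangent)
        as (_ & _ & E); unfold K; rewrite E.
      rewrite tangent_speed_eq by easy.
      specialize (HA u Hu'); specialize (HB u Hu').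
      rewrite !csqrt_eq, cinv_eq by (try easy; lra).
      assert (P1 : 0 < gram1 g u) by lra; assert (P2 : 0 < gram2 g u) by lra.
      assert (Hs1 := sqrt_lt_R0 _ P1); assert (Hs2 := sqrt_lt_R0 _ P2).
      assert (Q1 := sqrt_def _ (Rlt_le _ _ P1)); assert (Q2 := sqrt_def _ (Rlt_le _ _ P2)).
      set (a := sqrt (gram1 g u)) in *; set (b := sqrt (gram2 g u)) in *.
      rewrite <- Q1, <- Q2; field; lra.
  - unfold K; specialize (HA t Ht); specialize (HB t Ht).
    rewrite !csqrt_eq, cinv_eq by (try easy; lra).
    assert (P1 : 0 < gram1 g t) by lra; assert (P2 : 0 < gram2 g t) by lra.
    assert (Hs1 := sqrt_lt_R0 _ P1); assert (Hs2 := sqrt_lt_R0 _ P2).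
    assert (Q1 := sqrt_def _ (Rlt_le _ _ P1)); assert (Q2 := sqrt_def _ (Rlt_le _ _ P2)).
    set (a := sqrt (gram1 g t)) in *; set (b := sqrt (gram2 g t)) in *.
    rewrite <- Q1, <- Q2; field; lra.
Qed.

End Reparametrization.

(** * The P-functional *)

(** The P-integrand without its factor 2, in clamped form: [m2] guards the root of [<V, b0> - mu],
    and [m3] the squared speed of [V e]. The squared determinant over the cube of [gram1] is the
    squared geodesic curvature. *)
Definition spherical_density (m2 m3 mu : R) (b0 : R3) (V : R -> R -> R3) (e x : R) : R :=
  csqrt m2 (dot (V e x) b0 - mu)
  * (1 + det3 (V e x) (D (V e) x) (D (D (V e)) x) ^ 2 * cinv m3 (gram1 (V e) x) ^ 3)
  * csqrt m3 (gram1 (V e) x).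

Lemma smooth2_spherical_density (m2 m3 mu : R) (b0 : R3) (V : R -> R -> R3) :
  0 < m2 -> 0 < m3 -> smooth_family V -> smooth2 (spherical_density m2 m3 mu b0 V).
Proof.
  intros Hm2 Hm3 HV.
  assert (HV1 := smooth_family_D V HV); assert (HV2 := smooth_family_D _ HV1).
  assert (Hb := smooth_family_const _ (smooth_curve_const b0)).
  assert (Hf := smooth2_minus _ _ (smooth2_dot _ _ HV Hb) (smooth2_const mu)).
  assert (Hn := smooth2_gram1 V HV).
  assert (Hd : smooth2 (fun e x => det3 (V e x) (D (V e) x) (D (D (V e)) x)))
    by exact (smooth2_dot _ _ HV2 (smooth_family_cross _ _ HV HV1)).
  assert (Hi := smooth2_pow _ 3 (smooth2_comp1 _ _ (smooth_cinv m3 Hm3) Hn)).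
  exact (smooth2_mult _ _
    (smooth2_mult _ _ (smooth2_comp1 _ _ (smooth_csqrt m2 Hm2) Hf)
      (smooth2_plus _ _ (smooth2_const 1) (smooth2_mult _ _ (smooth2_pow _ 2 Hd) Hi)))
    (smooth2_comp1 _ _ (smooth_csqrt m3 Hm3) Hn)).
Qed.

Lemma Pfun_eq (m2 m3 mu l : R) (b0 : R3) (V : R -> R -> R3) (e : R) :
  0 < m2 -> 0 < m3 -> 0 <= l -> smooth_family V ->
  (forall x, 0 <= x <= l -> 2 * m2 <= dot (V e x) b0 - mu) ->
  (forall x, 0 <= x <= l -> 2 * m3 <= gram1 (V e) x) ->
  Pfun mu b0 l (V e) = 2 * RInt (spherical_density m2 m3 mu b0 V e) 0 l.
Proof.
  intros Hm2 Hm3 Hl HV Hf Hn; unfold Pfun; f_equal; apply RInt_ext; intros x.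
  rewrite Rmin_left, Rmax_right by easy; intros Hx.
  specialize (Hf x ltac:(lra)); specialize (Hn x ltac:(lra)).
  assert (Hp : 0 < gram1 (V e) x) by lra.
  rewrite geodesic_curvature_eq by (try easy; now apply smooth_family_slice).
  unfold spherical_density; rewrite !csqrt_eq, cinv_eq by easy.
  change (speed (V e) x) with (sqrt (gram1 (V e) x)).
  assert (Q := sqrt_def _ (Rlt_le _ _ Hp)); assert (Hs := sqrt_lt_R0 _ Hp).
  set (a := sqrt (gram1 (V e) x)) in *; rewrite <- Q; eq_R; field; lra.
Qed.

Section SphericalVariation.

Variables (mu L m : R) (g T : R -> R3) (b0 : R3).
Hypothesis HL : 0 < L.
Hypothesis Hm : 0 < m.
Hypothesis Hg : smooth_curve g.
Hypothesis HA : forall t, 0 <= t <= L -> 3 * m <= gram1 g t.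
Hypothesis HB : forall t, 0 <= t <= L -> 3 * m <= gram2 g t.
Hypothesis HT : smooth_curve T.

Let s := tangent_length m g.
Let v := fun t => csqrt m (gram1 g t).

Hypothesis HTs : forall t, 0 <= t <= L -> T (s t) = tangent g t.
Hypothesis Hmult : endpoint_multiplier mu L g b0.

Lemma tangent_multiplier (t : R) : 0 <= t <= L ->
  dot (T (s t)) b0 - mu = bending (gram1 g t) (gram2 g t) (triple g t).
Proof.
  intros Ht.
  pose proof (euler_lagrange mu L m g b0 HL Hm Hg HA HB Hmult t Ht) as E.
  rewrite (velocity_of_tangent L m g Hm HA T HTs t Ht) in E.
  specialize (HA t Ht); rewrite csqrt_eq in E by (try easy; lra).
  assert (HA' : 0 < gram1 g t) by lra; assert (Hs := sqrt_lt_R0 _ HA').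
  fold s in E.
  replace (dot b0 (scal (sqrt (gram1 g t)) (T (s t))))
    with (dot (T (s t)) b0 * sqrt (gram1 g t)) in E by (r3_simpl; ring).
  apply Rmult_eq_reg_r in E; lra.
Qed.

Lemma tangent_multiplier_pos (x : R) : 0 <= x <= s L -> 0 < dot (T x) b0 - mu.
Proof.
  intros Hx; destruct (tangent_length_onto L m g HL Hm Hg x Hx) as (t & Ht & <-).
  fold s; rewrite tangent_multiplier by easy.
  specialize (HA t Ht); specialize (HB t Ht); unfold bending.
  assert (0 < gram1 g t ^ 3) by (apply pow_lt; lra).
  assert (0 < gram2 g t ^ 3) by (apply pow_lt; lra).
  assert (0 <= triple g t ^ 2 * gram1 g t ^ 3 / gram2 g t ^ 3).
  { apply Rmult_le_pos; [apply Rmult_le_pos; [apply pow2_ge_0|lra]|].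
    now apply Rlt_le, Rinv_0_lt_compat. }
  apply Rmult_lt_0_compat; [apply Rdiv_lt_0_compat; lra|apply pow_lt; lra].
Qed.

(** A spherical variation is fixed near the ends in the arclength parameter of the tangent image.
    Continuity of [s] turns this into a neighbourhood of the ends in the parameter of [g], as needed
    for a variation of [g]. *)
Lemma tangent_length_near_ends (d : R) : 0 < d ->
  exists d', 0 < d' /\ forall t, 0 < t < L ->
    (t < d' -> s t <= d) /\ (L - d' < t -> s L - d <= s t).
Proof.
  intros Hd.
  assert (Hc := fun t => smooth_continuous s t (smooth_tangent_length m g Hm Hg)).
  destruct (proj1 (filterlim_locally (F := locally 0) _ _) (Hc 0) (mkposreal d Hd)) as [r0 H0].
  destruct (proj1 (filterlim_locally (F := locally L) _ _) (Hc L) (mkposreal d Hd)) as [r1 H1].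
  exists (Rmin r0 r1).
  pose proof (Rmin_l r0 r1); pose proof (Rmin_r r0 r1).
  split; [apply Rmin_pos; apply cond_pos|].
  intros t Ht; split; intros Htd.
  - assert (Hb : Rabs (s t - s 0) < d).
    { apply (H0 t); change (Rabs (t - 0) < r0); rewrite Rabs_pos_eq; lra. }
    apply Rabs_def2 in Hb.
    pose proof (tangent_length_0 m g) as Hs0; fold s in Hs0; lra.
  - assert (Hb : Rabs (s t - s L) < d).
    { apply (H1 t); change (Rabs (t - L) < r1); rewrite Rabs_left; lra. }
    apply Rabs_def2 in Hb; lra.
Qed.

(* With [x = kappa (1 + lambda ^ 2)] and [f = <V, b0> - mu], the Sadowsky
   integrand plus multiplier term is [(x ^ 2 + f) v], the P-integrand pulled back
   by [s] is [2 sqrt f x v], and the difference is [(x - sqrt f) ^ 2 v]. *)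
Lemma completed_square (m2 m3 : R) (V : R -> R -> R3) (G : R -> R -> R3) (e t : R) :
  0 < m2 -> 0 < m3 -> smooth_family V -> smooth_family G ->
  (forall x, 0 <= x <= s L -> dot (V e x) (V e x) = 1) ->
  (forall u, 0 <= u <= L -> D (G e) u = scal (v u) (V e (s u))) ->
  0 < t < L ->
  2 * m2 <= dot (V e (s t)) b0 - mu -> 2 * m3 <= gram1 (V e) (s t) ->
  2 * m <= gram1 (G e) t -> 2 * m <= gram2 (G e) t ->
  exists x, 0 <= x /\
    bending (gram1 (G e) t) (gram2 (G e) t) (triple (G e) t) = x ^ 2 /\
    family_density mu m G e t + dot b0 (scal (v t) (V e (s t)))
    - 2 * (tangent_speed m g t * spherical_density m2 m3 mu b0 V e (s t))
    = v t * (x - sqrt (dot (V e (s t)) b0 - mu)) ^ 2.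
Proof.
  intros Hm2 Hm3 HV HG H1 HGd Ht Hf Hn HA' HB'.
  destruct (spherical_grams L m g Hm Hg (G e) (V e) t
    (smooth_family_slice V e HV) H1 Ht HGd) as (E1 & E2 & E3).
  fold s in E1, E2, E3; change (csqrt m (gram1 g t)) with (v t) in E1, E2, E3.
  assert (Hv : 0 < v t) by now apply csqrt_pos.
  assert (Hs : 0 < tangent_speed m g t) by now apply tangent_speed_pos.
  assert (Hn' : 0 < gram1 (V e) (s t)) by lra.
  set (n := gram1 (V e) (s t)) in *.
  set (q := det3 (V e (s t)) (D (V e) (s t)) (D (D (V e)) (s t))) in *.
  set (w := v t) in *; set (s' := tangent_speed m g t) in *.
  exists (sqrt n * s' / w * (1 + q ^ 2 / n ^ 3)).
  assert (Hb : bending (gram1 (G e) t) (gram2 (G e) t) (triple (G e) t)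
    = (sqrt n * s' / w * (1 + q ^ 2 / n ^ 3)) ^ 2)
    by (rewrite E1, E2, E3; now apply bending_spherical).
  assert (Hsn := sqrt_lt_R0 n Hn').
  split; [|split; [easy|]].
  - apply Rmult_le_pos.
    + apply Rlt_le, Rdiv_lt_0_compat; [now apply Rmult_lt_0_compat|easy].
    + assert (0 <= q ^ 2 / n ^ 3); [|lra].
      apply Rmult_le_pos; [apply pow2_ge_0|apply Rlt_le, Rinv_0_lt_compat, pow_lt; easy].
  - unfold family_density; rewrite sadowsky_density_eq by easy.
    rewrite Hb, E1, sqrt_pow2 by lra.
    unfold spherical_density; fold n q.
    rewrite !csqrt_eq, cinv_eq by easy.
    set (f := dot (V e (s t)) b0 - mu) in *.
    replace (dot b0 (scal w (V e (s t)))) with (w * (f + mu)) by (unfold f; r3_simpl; ring).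
    assert (Qf := sqrt_def f ltac:(lra)); assert (Qn := sqrt_def n ltac:(lra)).
    set (a := sqrt f) in *; set (b := sqrt n) in *.
    rewrite <- Qf, <- Qn; field; lra.
Qed.

Lemma tangent_image_P_critical : P_critical mu b0 (s L) T.
Proof.
  split; [exact tangent_multiplier_pos|].
  intros V (HV & HVunit & HV0 & d & Hd & HVends).
  assert (Hs0 := tangent_length_0 m g); fold s in Hs0.
  assert (HsL : 0 < s L)
    by (rewrite <- Hs0; exact (tangent_length_incr m g Hm Hg 0 L HL)).
  assert (Hsm := smooth_tangent_length m g Hm Hg); fold s in Hsm.
  assert (Hsp := smooth_tangent_speed m g Hm Hg).
  assert (Hunit : forall e x, 0 <= x <= s L -> dot (V e x) (V e x) = 1).
  { intros e x Hx.
    rewrite <- (sqrt_def (dot (V e x) (V e x)) (dot_nonneg _)).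
    change (sqrt (dot (V e x) (V e x))) with (norm3 (V e x)).
    rewrite HVunit by easy; ring. }
  assert (Hf2 : smooth2 (fun e x => dot (V e x) b0 - mu)).
  { exact (smooth2_minus _ _ (smooth2_dot _ _ HV (smooth_family_const _ (smooth_curve_const b0)))
      (smooth2_const mu)). }
  destruct (positive_min (fun x => dot (T x) b0 - mu) 0 (s L)) as (m2 & Hm2 & Hfm);
    [lra|exact (smooth_minus _ _ (smooth_dot _ _ HT (smooth_curve_const b0)) (smooth_const mu))
    |exact tangent_multiplier_pos|].
  (* The squared speed of [T] is 1, which is three times this threshold. *)
  assert (Hm3 : 0 < / 3) by lra.
  assert (Lf : locally 0 (fun e => forall x, 0 <= x <= s L ->
    2 * m2 <= dot (V e x) b0 - mu)).
  { apply (uniform_lower_bound (fun e x => dot (V e x) b0 - mu)); [easy|easy|].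
    intros x Hx; rewrite HV0 by easy; now apply Hfm. }
  assert (Ln : locally 0 (fun e => forall x, 0 <= x <= s L -> 2 * / 3 <= gram1 (V e) x)).
  { apply (uniform_lower_bound (fun e => gram1 (V e))); [now apply smooth2_gram1|easy|].
    intros x Hx; replace (gram1 (V 0) x) with 1; [lra|].
    rewrite <- (tangent_image_arclength L m g HL Hm Hg HA HB T HT HTs x Hx).
    apply (smooth_eq_closure _ _ 0 (s L)); try easy.
    - now apply smooth_gram1.
    - now apply smooth_gram1, smooth_family_slice.
    - intros u Hu; unfold gram1; now rewrite (proj1 (base_jets (s L) T V u HV0 Hu)). }
  assert (Hv : smooth v).
  { apply (smooth_comp (csqrt m)); [now apply smooth_csqrt|now apply smooth_gram1]. }
  set (H := fun e t => scal (v t) (V e (s t))).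
  assert (HH : smooth_family H).
  { apply (smooth_family_scal (fun _ t => v t) (fun e t => V e (s t))).
    - now apply smooth2_snd.
    - now apply smooth_family_reparam. }
  set (G := curve_of_velocity (g 0) H).
  assert (HGs : smooth_family G) by now apply smooth_curve_of_velocity.
  assert (HGd : forall e, D (G e) = H e) by (intros e; now apply D_curve_of_velocity).
  assert (HvT : forall t, 0 <= t <= L -> D g t = scal (v t) (T (s t)))
    by exact (velocity_of_tangent L m g Hm HA T HTs).
  assert (Hrange := tangent_length_range L m g Hm Hg); fold s in Hrange.
  destruct (tangent_length_near_ends d Hd) as (d' & Hd' & Hnear).
  assert (HG : variation L g G).
  { apply (curve_of_velocity_variation L g H d' Hg HH HL Hd').
    - intros t Ht; unfold H; rewrite HV0 by (apply Hrange; lra).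
      symmetry; apply HvT; lra.
    - intros e t Ht Htd; unfold H; rewrite HVends.
      + symmetry; apply HvT; lra.
      + apply Hrange; lra.
      + destruct (Hnear t Ht); destruct Htd; [left|right]; auto. }
  assert (HG0 := proj1 (proj2 HG)).
  assert (LG := family_grams_bound L m g HL Hm Hg HA HB G HGs HG0).
  set (Q := spherical_density m2 (/ 3) mu b0 V).
  assert (HQ : smooth2 Q) by now apply smooth2_spherical_density.
  assert (HF := smooth2_family_density mu m Hm G HGs).
  set (E1 := fun e t => family_density mu m G e t + dot b0 (H e t)).
  set (E2 := fun e t => 2 * (tangent_speed m g t * Q e (s t))).
  assert (HE1 : smooth2 E1).
  { exact (smooth2_plus _ _ HF
      (smooth2_dot _ _ (smooth_family_const _ (smooth_curve_const b0)) HH)). }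
  assert (HQs := smooth2_reparam Q s HQ Hsm).
  assert (HE2 : smooth2 E2).
  { exact (smooth2_mult _ _ (smooth2_const 2) (smooth2_mult _ _ (smooth2_snd _ Hsp) HQs)). }
  (* The substitution [x = s t] moves the P-integral to [0, L], where its integrand can be compared
     pointwise with that of the Sadowsky functional. *)
  assert (HP : forall e, 2 * RInt (Q e) 0 (s L) = RInt (E2 e) 0 L).
  { intros e; rewrite <- Hs0 at 1.
    rewrite <- (RInt_comp (Q e) s (tangent_speed m g)).
    - symmetry; apply (RInt_mul (fun t => tangent_speed m g t * Q e (s t))).
      exact (smooth_mult _ _ Hsp (smooth2_slice _ e HQs)).
    - intros x _; now apply smooth_continuous, smooth2_slice.
    - intros x _; split; [now apply is_derive_tangent_length|now apply smooth_continuous]. }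
  assert (HSe : forall e, (forall t, 0 <= t <= L ->
      2 * m <= gram1 (G e) t /\ 2 * m <= gram2 (G e) t) ->
    Sadowsky mu L (G e) + dot b0 (minus (G e L) (G e 0)) = RInt (E1 e) 0 L).
  { intros e He; unfold G at 2 3; rewrite dot_curve_of_velocity by easy.
    rewrite (Sadowsky_eq_RInt_density mu L m (G e)) by
      (first [easy|now apply smooth_family_slice|intros; now apply He]).
    symmetry; apply (RInt_add (family_density mu m G e) (fun t => dot b0 (H e t))).
    - exact (smooth2_slice _ e HF).
    - exact (smooth_dot _ _ (smooth_curve_const b0) (smooth_family_slice _ e HH)). }
  assert (HdP : is_derive (fun e => 2 * RInt (Q e) 0 (s L)) 0 (2 * RInt (d1 Q 0) 0 (s L))).
  { apply (is_derive_scal (fun e => RInt (Q e) 0 (s L))).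
    now apply is_derive_RInt_smooth2. }
  assert (HdE := Hmult G HG).
  assert (Hsquare := fun e t Hx => completed_square m2 (/ 3) V G e t Hm2 Hm3 HV HGs
    (Hunit e) (fun u _ => f_equal (fun h => h u) (HGd e)) Hx).
  assert (Hzero : 2 * RInt (d1 Q 0) 0 (s L) = 0).
  { apply (tangency_derivative _ _ 0 _ HdE HdP).
    - generalize LG (filter_and _ _ Lf Ln); apply locally_imp2; intros e He [Hef Hen].
      rewrite HP, HSe by easy.
      apply RInt_le; [lra|apply smooth_ex_RInt; now apply smooth2_slice
                     |apply smooth_ex_RInt; now apply smooth2_slice|].
      intros t Ht; assert (Ht' : 0 <= t <= L) by lra.
      destruct (Hsquare e t Ht (Hef _ (Hrange t Ht')) (Hen _ (Hrange t Ht'))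
        (proj1 (He t Ht')) (proj2 (He t Ht'))) as (x & _ & _ & Hx).
      assert (0 <= v t * (x - sqrt (dot (V e (s t)) b0 - mu)) ^ 2).
      { apply Rmult_le_pos; [now apply Rlt_le, csqrt_pos|apply pow2_ge_0]. }
      unfold E1, E2; fold Q in Hx; unfold H at 1; lra.
    - assert (He := locally_singleton _ _ LG); assert (Hef := locally_singleton _ _ Lf);
        assert (Hen := locally_singleton _ _ Ln).
      rewrite HP, HSe by easy.
      apply RInt_ext; intros t; rewrite Rmin_left, Rmax_right by lra; intros Ht.
      assert (Ht' : 0 <= t <= L) by lra.
      destruct (Hsquare 0 t Ht (Hef _ (Hrange t Ht')) (Hen _ (Hrange t Ht'))
        (proj1 (He t Ht')) (proj2 (He t Ht'))) as (x & Hx0 & Hxb & Hx).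
      destruct (base_jets L g G t HG0 Ht) as (J1 & J2 & J3).
      (* At parameter 0 the Euler-Lagrange equation says that [x^2] equals [<T, b0> - mu]. As [x] is
         nonnegative, it is the square root, and the square in the difference of the integrands
         vanishes. *)
      assert (Hm0 := tangent_multiplier t Ht').
      rewrite HV0 in Hx by now apply Hrange.
      unfold gram1, gram2, triple in Hxb, Hm0; rewrite J1, J2, J3, <- Hm0 in Hxb.
      rewrite Hxb, sqrt_pow2 in Hx by easy.
      replace (v t * (x - x) ^ 2) with 0 in Hx by ring.
      unfold E1, E2; fold Q in Hx; unfold H at 1; rewrite HV0 by now apply Hrange.
      eq_R; lra. }
  rewrite Hzero in HdP.
  (* For parameters near 0 the lower bounds hold along all of [V e], so [Pfun] coincides there with
     its clamped form and has the same derivative. *)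
  apply (is_derive_ext_loc (fun e => 2 * RInt (Q e) 0 (s L))); [|exact HdP].
  generalize Lf Ln; apply locally_imp2; intros e Hef Hen.
  symmetry; apply (Pfun_eq m2 (/ 3)); try easy; lra.
Qed.

End SphericalVariation.

Theorem mainTheorem5 (mu L : R) (gamma : R -> R3) (Lt : R) (T : R -> R3)
  (hL : 0 < L)
  (hgamma : frenet_curve L gamma)
  (hT : arclength_tangent L gamma Lt T)
  (hcrit : Sadowsky_critical mu L gamma) :
  (forall t, 0 <= t <= L ->
     geodesic_curvature T (arclength (tangent gamma) t)
     = modified_torsion gamma t) /\
  exists b0 : R3,
    endpoint_multiplier mu L gamma b0 /\ P_critical mu b0 Lt T.
Proof.
  assert (Hg := proj1 hgamma).
  destruct (positive_min (gram1 gamma) 0 L) as (mA & HmA & HA);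
    [lra|now apply smooth_gram1|intros t Ht; now apply (frenet_gram L)|].
  destruct (positive_min (gram2 gamma) 0 L) as (mB & HmB & HB);
    [lra|now apply smooth_gram2|intros t Ht; now apply (frenet_gram L)|].
  set (m := Rmin mA mB).
  assert (Hm : 0 < m) by now apply Rmin_pos.
  pose proof (Rmin_l mA mB : m <= mA); pose proof (Rmin_r mA mB : m <= mB).
  assert (HA' : forall t, 0 <= t <= L -> 3 * m <= gram1 gamma t)
    by (intros t Ht; specialize (HA t Ht); lra).
  assert (HB' : forall t, 0 <= t <= L -> 3 * m <= gram2 gamma t)
    by (intros t Ht; specialize (HB t Ht); lra).
  destruct hT as (HT & -> & HTs).
  assert (Hs := arclength_tangent_eq L m gamma Hm Hg HA' HB').
  assert (HTs' : forall t, 0 <= t <= L -> T (tangent_length m gamma t) = tangent gamma t)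
    by (intros t Ht; rewrite <- Hs by easy; now apply HTs).
  split.
  - intros t Ht; rewrite Hs by easy.
    now apply (geodesic_curvature_tangent L m gamma hL Hm Hg HA' HB' T HT HTs').
  - destruct (multiplier_exists mu L m gamma hL Hm Hg HA' HB' hcrit) as (b0 & Hb0).
    exists b0; split; [easy|].
    rewrite Hs by lra.
    now apply (tangent_image_P_critical mu L m gamma T b0 hL Hm Hg HA' HB' HT HTs').
Qed.
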